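(* Let $d>0$, $c>0$, $\rho=e^{-c}$, and $$V(d)=\frac{2(d-1+e^{-d})}{d^2},\quad I(c)=\frac{2c^2\rho^2(1+\rho^2)}{(1-\rho^2)^2},\quad M_2(c)=\frac{2c^4\rho^2(7\rho^6+19\rho^4+5\rho^2+1)}{(1-\rho^2)^4}.$$ Then the Fisher metric at $\mu=0$ of the limiting quotient experiment in the coordinates $(\beta,\mu)$, $$g_F^{\mathrm{quot}}=\begin{pmatrix}I(c)&-cV(d)I(c)\\-cV(d)I(c)&V(d)^2M_2(c)\end{pmatrix},$$ is positive definite. Equivalently, after elimination of the nuisance coordinate $\beta$, $$I^{\mathrm{eff}}_{\mu\mu}=V(d)^2\bigl[M_2(c)-c^2I(c)\bigr]>0.$$ More explicitly, $$M_2(c)-c^2I(c)=\frac{4c^4\rho^4(\rho^2+3)(3\rho^2+1)}{(1-\rho^2)^4}>0.$$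
   Context: The limiting quotient experiment: fix $A,\Delta t>0$, $d=A\Delta t$; for $\beta\in\mathbb R$ let $c=e^\beta\Delta t/2$, $\rho=e^{-c}$, and $p_\beta$ the density of the centered circular complex Gaussian pair $(Y_0,Y_1)$ with unit variances $\mathbb E|Y_j|^2=1$ and $\mathbb E[Y_1\overline{Y_0}]=\rho$. With $Z$ the stationary Gaussian Ornstein–Uhlenbeck process of covariance $e^{-A|t-s|}$ and $\delta_\lambda=\log\bigl(\frac1{\Delta t}\int_0^{\Delta t}e^{\lambda Z_s-\lambda^2/2}ds\bigr)$, put $p_{\beta,\lambda}=\mathbb E_Z[p_{\beta+\delta_\lambda}]$, which depends on $\lambda$ only through $\mu=\lambda^2/2\ge0$. At $\mu=0$ the scores are $S_\beta=q=\partial_\beta\log p_\beta$ and $S_\mu=V(d)k$ with $k=\partial^2_{\beta\beta}\log p_\beta-q+q^2$, and $I(c)=\mathbb E[q^2]$, $M_2(c)=\mathbb E[k^2]$, $\mathbb E[qk]=-cI(c)$, so that the Fisher matrix is the displayed one. $I^{\mathrm{eff}}_{\mu\mu}$ denotes the Schur complement of the $\beta$ entry. *)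

(* Defs.v *)
From HB Require Import structures.
From mathcomp Require Import all_boot all_order all_algebra.
From mathcomp Require Import complex.
From mathcomp Require Import all_classical all_reals all_analysis.

Set Implicit Arguments.
Unset Strict Implicit.
Unset Printing Implicit Defensive.

Import Order.TTheory GRing.Theory Num.Theory.
Import numFieldNormedType.Exports.

Local Open Scope classical_set_scope.
Local Open Scope ring_scope.

(* Density, with respect to Lebesgue measure on C^n = R^(2n), of the centered
   circular complex Gaussian vector Y with covariance G = E[Y Y^*]:
   exp (- y^* G^-1 y) / (pi^n det G).  For Hermitian G both y^* G^-1 y and
   det G are real, so taking real parts only changes the type. *)
Definition cgauss_pdf (R : realType) (n : nat) (G : 'M[R[i]]_n)
    (y : 'cV[R[i]]_n) : R :=
  expR (- complex.Re ((map_mx Num.conj y^T *m invmx G *m y) 0 0))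
    / (pi ^+ n * complex.Re (\det G)).

(* C and C^2 are represented by R * R and (R * R) * (R * R), with points
   ((Re y0, Im y0), (Re y1, Im y1)), so that Lebesgue measure on them is a
   product of one-dimensional ones. *)
Notation C2 R :=
  ((measurableTypeR R * measurableTypeR R)
     * (measurableTypeR R * measurableTypeR R))%type.

Definition vec_of_C2 (R : realType) (y : C2 R) : 'cV[R[i]]_2 :=
  \col_j if j == 0 then Complex y.1.1 y.1.2 else Complex y.2.1 y.2.2.

(* For [m1 \x m2] the sigma-finite instance found by inference is the one for
   subprobabilities, whence the explicit instance on a named constant. *)
Definition lebesgue_C (R : realType) :
    set (measurableTypeR R * measurableTypeR R) -> \bar R :=
  (@lebesgue_measure R \x @lebesgue_measure R)%E.

HB.instance Definition _ (R : realType) := Measure.on (@lebesgue_C R).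

Lemma lebesgue_C_sigma_finite (R : realType) :
  sigma_finite [set: measurableTypeR R * measurableTypeR R] (@lebesgue_C R).
Proof.
have /sigma_finiteP[F [TF ndF Foo]] := sigma_finiteT (@lebesgue_measure R).
exists (fun n => F n `*` F n).
  rewrite -setXTT TF predeqE => -[x y]; split.
    move=> [/= [n _ Fnx] [k _ Fky]]; exists (maxn n k) => //; split.
    - by move: x Fnx; exact/subsetPset/ndF/leq_maxl.
    - by move: y Fky; exact/subsetPset/ndF/leq_maxr.
  by move=> [n _ []/= ? ?]; split; exists n.
move=> k; have [mF oF] := Foo k; split; first exact: measurableX.
by rewrite /lebesgue_C product_measure1E// lte_mul_pinfty// ge0_fin_numE.
Qed.

HB.instance Definition _ (R : realType) :=
  Measure_isSigmaFinite.Build _ _ _ (@lebesgue_C R)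
    (@lebesgue_C_sigma_finite R).

Definition cov_rho (R : realType) (rho : R) : 'M[R[i]]_2 :=
  \matrix_(j, k) if j == k then 1 else (rho%:C)%C.

Definition c_of (R : realType) (dt beta : R) : R := expR beta * dt / 2.

Definition p_beta (R : realType) (dt beta : R) (y : C2 R) : R :=
  cgauss_pdf (cov_rho (expR (- c_of dt beta))) (vec_of_C2 y).

(* [normal_prob m 0] of the library is not the Dirac mass at m, so the
   degenerate Gaussian law is treated separately. *)
Definition gauss_law (R : realType) (m s : R) (B : set R) : \bar R :=
  if s == 0 then \d_m B else normal_prob m s B.

Definition gaussian_process (R : realType) (disp : measure_display)
    (Omega : measurableType disp) (P : probability Omega R)
    (Z : R -> Omega -> R) : Prop :=
  forall (n : nat) (t a : 'I_n -> R), exists m s : R,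
  forall B : set R, measurable B ->
    P ((fun w => \sum_(i < n) a i * Z (t i) w) @^-1` B) = gauss_law m s B.

(* The stationary Ornstein-Uhlenbeck process with covariance exp(-A|t-s|).
   Joint measurability in (t, w) is the only path regularity required: it makes
   the time integrals below meaningful, and it holds in particular for the
   version with continuous paths. *)
Definition stationary_OU (R : realType) (disp : measure_display)
    (Omega : measurableType disp) (P : probability Omega R)
    (A : R) (Z : R -> Omega -> R) : Prop :=
  [/\ measurable_fun [set: R * Omega] (fun x : R * Omega => Z x.1 x.2),
      gaussian_process P Z,
      (forall t, 'E_P[Z t] = 0)%E &
      (forall s t, covariance P (Z s) (Z t) = (expR (- (A * `|t - s|)))%:E)].

Section experiment.
Variables (R : realType) (disp : measure_display).
Variables (Omega : measurableType disp) (P : probability Omega R).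
Variables (dt : R) (Z : R -> Omega -> R).

Definition delta (lambda : R) (w : Omega) : R :=
  ln (dt^-1 * \int[lebesgue_measure]_(s in `[0, dt])
                 expR (lambda * Z s w - lambda ^+ 2 / 2)).

Definition p_beta_lambda (beta lambda : R) (y : C2 R) : R :=
  \int[P]_w p_beta dt (beta + delta lambda w) y.

Definition p_beta_mu (beta mu : R) (y : C2 R) : R :=
  p_beta_lambda beta (Num.sqrt (2 * mu)) y.

Definition score_beta (beta : R) (y : C2 R) : R :=
  derive1 (fun b : R => ln (p_beta_mu b 0 y)) beta.

(* mu = 0 is a boundary point of the parameter range mu >= 0, whence the
   one-sided derivative. *)
Definition score_mu (beta : R) (y : C2 R) : R :=
  lim ((ln (p_beta_mu beta h y) - ln (p_beta_mu beta 0 y)) / h @[h --> 0^'+]).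

Definition score (j : 'I_2) : R -> C2 R -> R :=
  if j == 0 then score_beta else score_mu.

(* Fisher metric at (beta, mu) = (beta, 0); index 0 is beta, index 1 is mu. *)
Definition fisher (beta : R) : 'M[R]_2 :=
  \matrix_(j, k) \int[(@lebesgue_C R \x @lebesgue_C R)%E]_y
    (score j beta y * score k beta y * p_beta_mu beta 0 y).

End experiment.

Definition Vfun (R : realType) (d : R) : R := 2 * (d - 1 + expR (- d)) / d ^+ 2.

Definition Ifun (R : realType) (c : R) : R :=
  let rho := expR (- c) in
  2 * c ^+ 2 * rho ^+ 2 * (1 + rho ^+ 2) / (1 - rho ^+ 2) ^+ 2.

Definition M2fun (R : realType) (c : R) : R :=
  let rho := expR (- c) in
  2 * c ^+ 4 * rho ^+ 2 * (7 * rho ^+ 6 + 19 * rho ^+ 4 + 5 * rho ^+ 2 + 1)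
    / (1 - rho ^+ 2) ^+ 4.

Definition g_quot (R : realType) (d c : R) : 'M[R]_2 :=
  \matrix_(j, k)
    if j == 0 then (if k == 0 then Ifun c else - (c * Vfun d * Ifun c))
    else (if k == 0 then - (c * Vfun d * Ifun c) else Vfun d ^+ 2 * M2fun c).

Definition posdefmx (R : realType) (n : nat) (G : 'M[R]_n) : Prop :=
  G^T = G /\ forall v : 'rV[R]_n, v != 0 -> 0 < (v *m G *m v^T) 0 0.

(* Schur complement of the entry (0, 0), i.e. of the nuisance coordinate beta *)
Definition I_eff (R : realType) (G : 'M[R]_2) : R :=
  G 1 1 - G 1 0 * (G 0 0)^-1 * G 0 1.

(* Main.v *)
Require Import Defs.
From HB Require Import structures.
From mathcomp Require Import all_boot all_order all_algebra.
From mathcomp Require Import complex ring lra.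
From mathcomp Require Import all_classical all_reals all_analysis.
From mathcomp Require Import measurable_realfun.

Set Implicit Arguments.
Unset Strict Implicit.
Unset Printing Implicit Defensive.

Import Order.TTheory GRing.Theory Num.Theory.
Import numFieldNormedType.Exports.

Local Open Scope classical_set_scope.
Local Open Scope ring_scope.

(** The displayed matrix has two sources: the random shift
    delta = ln M, where M is the average over [0, dt] of the field
    exp (lambda Z_s - lambda^2 / 2), and the Gaussian pair law itself.

    The scores.  Since c_of dt (beta + ln m) = c m, the mixture density is
    E f(M) with f(m) = p(c m), p being the density as a function of its rate
    parameter.  The field has mean 1, so E M = 1, and its covariance is
    exp (lambda^2 r) - 1 with r = exp (- A |t - s|); as 0 <= r <= 1, this is
    lambda^2 r up to the factor exp (lambda^2), and the mean of r over the
    square [0, dt]^2 is V(A dt).  Hence Var M / lambda^2 tends to V, while by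
    Jensen E (M - 1)^4 is at most the fourth moment of one value of the field,
    which is o(lambda^2).  A second-order expansion of f at 1 gives
      E f(M) = f(1) + lambda^2 V f''(1) / 2 + o(lambda^2),
    with no first-order term, and as mu = lambda^2 / 2 the score in mu is
    V c^2 p''/p, that is, V k (score_muE).  The expansion is uniform because f
    is bounded, except on the diagonal y0 = y1 where p blows up as c tends to
    0; the null set where Re y0 = Re y1 contains it and is discarded
    (integral_eq_off_null).

    The Fisher integrals.  Conditionally on Y0, the variable Y1 - rho Y0 is
    centered with variance 1 - rho^2, and real and imaginary parts are
    independent with the same law.  So q = q_x + q_z and
    k = k_x + k_z + 2 q_x q_z, where q_x and k_x are polynomials in two
    independent real Gaussian variables with E q_x = E k_x = 0.  This gives
    E q^2 = 2 E q_x^2, E qk = 2 E q_x k_x and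
    E k^2 = 2 E k_x^2 + 4 (E q_x^2)^2, and these moments are computed from the
    recursion that integration by parts yields (central_momentE).

    Positivity.  M_2 - c^2 I reduces to the displayed fraction with positive
    terms; it is, up to V^2, the Schur complement of the entry I > 0, and
    completing the square shows that the quadratic form is positive. *)

(** * Integrals against normal densities *)

(** The bound on the L1 norm is carried along with the value: in an iterated
    integral it is what makes the integrand integrable on the product
    (has_integral_fiber). *)
Definition has_integral d (T : measurableType d) (R : realType)
    (mu : {measure set T -> \bar R}) (f : T -> R) (a B : R) : Prop :=
  [/\ mu.-integrable setT (EFin \o f),
      (\int[mu]_x (f x)%:E = a%:E)%E &
      (\int[mu]_x `|f x|%:E <= B%:E)%E].

Section normal_moments.
Context {R : realType}.
Implicit Types (m s t x : R).
Local Notation mu := (@lebesgue_measure R).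

Lemma integral_FTC (F f : R -> R) (a b : R) : a < b ->
  (forall x : R, is_derive (x : R) 1 F (f x)) -> continuous f ->
  (\int[mu]_(x in `[a, b]) (f x)%:E = (F b - F a)%:E)%E.
Proof.
move=> ab dF cf.
have cF x : {for x, continuous F}.
  by apply/differentiable_continuous/derivable1_diffP; case: (dF x).
rewrite (@continuous_FTC2 _ f F) ?EFinB//.
- exact: continuous_subspaceT.
- split.
  + by move=> x _; case: (dF x).
  + exact: cvg_at_right_filter (cF _).
  + exact: cvg_at_left_filter (cF _).
- by move=> x _; rewrite derive1E; apply: derive_val.
Qed.

(** On [c - k, c + k] the integral is a difference of boundary values of F,
    which vanishes as k grows; dominated convergence does the rest. *)
Lemma integral_derive_eq0 (F f : R -> R) (c : R) :
  continuous f -> (forall x, is_derive x 1 F (f x)) ->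
  mu.-integrable setT (EFin \o f) ->
  F (c + k%:R) @[k --> \oo] --> 0 -> F (c - k%:R) @[k --> \oo] --> 0 ->
  (\int[mu]_x (f x)%:E = 0)%E.
Proof.
move=> cf dF intf Fp Fm.
pose fk (k : nat) : R -> \bar R := (EFin \o f) \_ `[c - k%:R, c + k%:R].
have mf := measurable_int _ intf.
have lim1 : (\int[mu]_x fk k x)%E @[k --> \oo] --> (\int[mu]_x (f x)%:E)%E.
  apply: (@dominated_cvg _ _ _ mu setT measurableT fk (EFin \o f)
            (abse \o (EFin \o f))) => //.
  - move=> k; apply/(measurable_restrictT _ _).1 => //.
    exact: measurable_funTS.
  - move=> x _; apply: cvg_near_cst; near=> k.
    rewrite /fk patchE mem_set//= in_itv/=.
    have : `|x - c| <= k%:R by near: k; exact: nbhs_infty_ger.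
    rewrite ler_distl => /andP[h1 h2]; apply/andP; split; lra.
  - exact: integrable_abse.
  - move=> k x _; rewrite /fk patchE; case: ifP => _ //=.
    by rewrite normr0 lee_fin.
have lim2 : (\int[mu]_x fk k x)%E @[k --> \oo] --> (0%:E : \bar R).
  apply: (@cvg_trans _ ((F (c + k%:R) - F (c - k%:R))%:E @[k --> \oo])).
    apply: near_eq_cvg; near=> k.
    have k0 : (0 < k%:R :> R).
      by rewrite ltr0n; near: k; exact: nbhs_infty_gt.
    by rewrite /fk -integral_mkcond (integral_FTC _ dF cf)//; lra.
  apply: cvg_EFin; first exact: nearW.
  rewrite -[X in _ --> X](subr0 0).
  exact: cvgB.
exact: cvg_unique lim1 lim2.
Unshelve. all: by end_near. Qed.

(** Completing the square: an exponential tilt shifts the mean. *)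
Lemma expR_mul_normal_pdf m s t x : s != 0 ->
  expR (t * x) * normal_pdf m s x =
  expR (t * m + t ^+ 2 * s ^+ 2 / 2) * normal_pdf (m + t * s ^+ 2) s x.
Proof.
move=> s0; rewrite !normal_pdfE// /normal_fun.
rewrite mulrCA [RHS]mulrCA -!expRD; congr (_ * expR _).
by rewrite -mulr_natr; field.
Qed.

Lemma mgf_normal m s t : s != 0 ->
  (\int[mu]_x (expR (t * x) * normal_pdf m s x)%:E =
     (expR (t * m + t ^+ 2 * s ^+ 2 / 2))%:E)%E.
Proof.
move=> s0.
under eq_integral do rewrite expR_mul_normal_pdf// EFinM.
rewrite integralZl//; last exact: integrable_normal_pdf.
by rewrite integral_normal_pdf mule1.
Qed.

Lemma integrable_expR_normal m s t : s != 0 ->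
  mu.-integrable setT (fun x => (expR (t * x) * normal_pdf m s x)%:E).
Proof.
move=> s0.
under eq_fun do rewrite expR_mul_normal_pdf// EFinM.
by apply: integrableZl => //; exact: integrable_normal_pdf.
Qed.

Lemma exprn_le_expR n x : 0 <= x -> x ^+ n <= n`!%:R * expR x.
Proof.
case: n => [|n] x0; first by rewrite expr0 fact0 mul1r -expR0 ler_expR.
rewrite mulrC -ler_pdivrMr ?ltr0n ?fact_gt0//.
by apply: le_trans (expR_ge1Dxn n x0); rewrite lerDr.
Qed.

Lemma measurable_central_power m s n :
  measurable_fun setT (fun x => (x - m) ^+ n * normal_pdf m s x).
Proof.
apply: measurable_funM; last exact: measurable_normal_pdf.
by apply: measurable_funX; exact: measurable_funB.
Qed.

(** |x - m|^n is at most n! (e^(x - m) + e^(m - x)), whose integrals are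
    finite by the formula for the moment generating function. *)
Lemma integrable_central_power m s n : s != 0 ->
  mu.-integrable setT (fun x => ((x - m) ^+ n * normal_pdf m s x)%:E).
Proof.
move=> s0.
pose g x : \bar R := ((n`!%:R * expR (- m))%:E * (expR (1 * x) * normal_pdf m s x)%:E +
  (n`!%:R * expR m)%:E * (expR (-1 * x) * normal_pdf m s x)%:E)%E.
apply: (@le_integrable _ _ _ mu setT measurableT _ g).
- by apply/measurable_EFinP; exact: measurable_central_power.
- move=> x _; rewrite /g /= lee_fin [leRHS]ger0_norm; last first.
    apply: addr_ge0; rewrite mulr_ge0 ?mulr_ge0 ?expR_ge0 ?normal_pdf_ge0//.
  rewrite normrM (ger0_norm (normal_pdf_ge0 _ _ _)).
  rewrite !mulrA -mulrDl ler_wpM2r ?normal_pdf_ge0//.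
  rewrite normrX (le_trans (exprn_le_expR _ _))//.
  rewrite -!(mulrA _ (expR _) (expR _)) -!expRD -mulrDr ler_wpM2l//.
  case: (lerP 0 (x - m)) => h.
    by rewrite ger0_norm// mul1r (addrC x) lerDl expR_ge0.
  by rewrite ltr0_norm// opprB mulN1r lerDr expR_ge0.
- apply: integrableD => //; apply: integrableZl => //;
    exact: integrable_expR_normal.
Qed.

Lemma is_derive_normal_pdf m s x : s != 0 ->
  is_derive x 1 (normal_pdf m s) (- (x - m) / s ^+ 2 * normal_pdf m s x).
Proof.
move=> s0; rewrite normal_pdfE// /normal_fun.
apply: is_derive_eq.
rewrite /GRing.scale/= -mulr_natr.
by field.
Qed.

(** The two ends of the line are the cases e = 1 and e = -1. *)
Lemma central_power_normal_pdf_cvg0 m s n (e : R) : s != 0 -> e ^+ 2 = 1 ->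
  (m + e * k%:R - m) ^+ n * normal_pdf m s (m + e * k%:R) @[k --> \oo] --> 0.
Proof.
move=> s0 e1.
pose K : R := n.+1`!%:R * (s ^+ 2 * 2) ^+ n.+1 * normal_peak s.
have s2 : 0 < s ^+ 2 * 2 by rewrite mulr_gt0 ?exprn_even_gt0.
have K0 : 0 <= K by rewrite !mulr_ge0 ?exprn_ge0 ?normal_peak_ge0 ?(ltW s2).
have en j : `|e ^+ j| = 1.
  rewrite normrX (_ : `|e| = 1) ?expr1n//.
  by apply/eqP; rewrite -(@pexpr_eq1 _ _ 2)// -normrX e1 normr1.
apply/norm_cvg0P.
apply: (@squeeze_cvgr _ _ _ _ (fun=> 0) (fun k : nat => K * k%:R^-1)).
- near=> k.
  have k1 : (1 <= k%:R :> R) by rewrite ler1n; near: k; exact: nbhs_infty_gt.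
  have k0 : (0 < k%:R :> R) by rewrite (lt_le_trans _ k1).
  rewrite normr_ge0/= addrAC subrr add0r normrM.
  rewrite exprMn normrM en mul1r (ger0_norm (normal_pdf_ge0 _ _ _)).
  rewrite ger0_norm ?exprn_ge0 ?(ltW k0)// ler_pdivlMr//.
  rewrite normal_pdfE// /normal_fun addrAC subrr add0r exprMn e1 mul1r.
  rewrite /K [leLHS](_ : _ = (k%:R ^+ n * k%:R *
     expR (- k%:R ^+ 2 / (s ^+ 2 *+ 2))) * normal_peak s); last by ring.
  rewrite ler_wpM2r ?normal_peak_ge0//.
  rewrite -exprSr mulNr expRN ler_pdivrMr ?expR_gt0//.
  (* u^(n+1) <= (n+1)! e^u at u = k^2 / (2 s^2) gives
     k^(n+1) e^(-u) <= k^(2n+2) e^(-u) <= constant. *)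
  have := @exprn_le_expR n.+1 (k%:R ^+ 2 / (s ^+ 2 *+ 2)).
  rewrite -(mulr_natr (s ^+ 2)) => /(_ (ltac:(rewrite divr_ge0 ?exprn_ge0 ?(ltW s2) ?(ltW k0)//))).
  rewrite exprMn exprVn ler_pdivrMr ?exprn_gt0// => h.
  rewrite -mulrA [X in _ <= _ * X]mulrC mulrA; apply: le_trans h.
  by rewrite -exprM mulnC ler_weXn2l// leq_pmulr.
- exact: cvg_cst.
- suff kV : (k%:R^-1 : R) @[k --> \oo] --> (0 : R).
    by have := cvgM (cvg_cst K) kV; rewrite mulr0; exact.
  apply/gtr0_cvgV0; last exact: cvgr_idn.
  by near=> k; rewrite ltr0n; near: k; exact: nbhs_infty_gt.
Unshelve. all: by end_near. Qed.

(** Moments of the centered normal law of variance v.  The recursive form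
    lets them reduce on numeral exponents, so that expectations of explicit
    polynomials become rational expressions. *)
Fixpoint central_moment (n : nat) (v : R) : R :=
  match n with
  | 0 => 1
  | 1 => 0
  | k.+2 => k.+1%:R * v * central_moment k v
  end.

(** Integration by parts: the derivative of
    s^2 (x - m)^n normal_pdf(x) integrates to zero.  For n = 0 the factor n
    cancels the term with the truncated exponent n.-1. *)
Lemma central_moment_rec m s n : s != 0 ->
  (\int[mu]_x ((x - m) ^+ n.+1 * normal_pdf m s x)%:E =
   (n%:R * s ^+ 2)%:E * \int[mu]_x ((x - m) ^+ n.-1 * normal_pdf m s x)%:E)%E.
Proof.
move=> s0.
have E1 : (\int[mu]_x ((n%:R * s ^+ 2) * ((x - m) ^+ n.-1 * normal_pdf m s x)
    - (x - m) ^+ n.+1 * normal_pdf m s x)%:E = 0)%E.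
  apply: (@integral_derive_eq0
     (fun x => s ^+ 2 * ((x - m) ^+ n * normal_pdf m s x)) _ m).
  - move=> x; apply: cvgB; [apply: cvgM; first exact: cvg_cst|];
      (apply: cvgM; last exact: continuous_normal_pdf);
      (apply: (@continuous_comp _ _ _ (fun x => x - m) (fun x => x ^+ _));
       last exact: exprn_continuous);
      apply: cvgB; [exact: cvg_id|exact: cvg_cst|exact: cvg_id|exact: cvg_cst].
  - move=> x.
    have d := is_derive_normal_pdf m x s0.
    have dX : is_derive x 1 (fun x => (x - m) ^+ n) (n%:R * (x - m) ^+ n.-1).
      rewrite (_ : (fun _ => _) = (fun x => x - m) ^+ n); last first.
        by apply/funext => z; rewrite exprfctE.
      by apply: is_derive_eq; rewrite /GRing.scale/= subr0 mulr1.
    have dM : is_derive x 1 (fun x => (x - m) ^+ n * normal_pdf m s x)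
        ((x - m) ^+ n * (- (x - m) / s ^+ 2 * normal_pdf m s x) +
         normal_pdf m s x * (n%:R * (x - m) ^+ n.-1)).
      exact: is_deriveM.
    apply: is_derive_eq; rewrite /GRing.scale/= (exprSr (x - m)).
    by field.
  - rewrite (_ : _ \o _ =
        ((fun x => (n%:R * s ^+ 2)%:E * ((x - m) ^+ n.-1 * normal_pdf m s x)%:E) \-
         (fun x => ((x - m) ^+ n.+1 * normal_pdf m s x)%:E))%E); last first.
      by apply/funext => x /=; rewrite EFinB EFinM.
    apply: integrableB => //; last exact: integrable_central_power.
    by apply: integrableZl => //; exact: integrable_central_power.
  - have := @central_power_normal_pdf_cvg0 m s n 1 s0 (expr1n _ _).
    under eq_fun do rewrite mul1r.
    by move=> /(cvgM (cvg_cst (s ^+ 2))); rewrite mulr0; exact.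
  - have := @central_power_normal_pdf_cvg0 m s n (-1) s0 (ltac:(by rewrite sqrrN expr1n)).
    under eq_fun do rewrite mulN1r.
    by move=> /(cvgM (cvg_cst (s ^+ 2))); rewrite mulr0; exact.
have i1 := integrable_central_power m n.-1 s0.
have i2 := integrable_central_power m n.+1 s0.
move: E1; under eq_integral do rewrite EFinB EFinM.
rewrite integralB//; last exact: integrableZl.
rewrite integralZl// => /eqP; rewrite sube_eq ?add0e; last 2 first.
- by rewrite fin_numM//; exact: integrable_fin_num.
- rewrite fin_num_adde_defl//; exact: integrable_fin_num.
by move/eqP => ->.
Qed.

Lemma central_momentE m s n : s != 0 ->
  (\int[mu]_x ((x - m) ^+ n * normal_pdf m s x)%:E =
   (central_moment n (s ^+ 2))%:E)%E.
Proof.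
move=> s0.
suff [] : ((\int[mu]_x ((x - m) ^+ n * normal_pdf m s x)%:E =
   (central_moment n (s ^+ 2))%:E) /\
   (\int[mu]_x ((x - m) ^+ n.+1 * normal_pdf m s x)%:E =
   (central_moment n.+1 (s ^+ 2))%:E))%E by [].
elim: n => [|n [IH1 IH2]]; split => //.
- under eq_integral do rewrite expr0 mul1r.
  by rewrite integral_normal_pdf.
- by rewrite central_moment_rec// mul0r mul0e.
- by rewrite central_moment_rec// IH1 -EFinM.
Qed.

Lemma has_integral_central_power m s n : s != 0 ->
  has_integral mu (fun x => (x - m) ^+ n * normal_pdf m s x)
    (central_moment n (s ^+ 2)) (1 + central_moment (n * 2) (s ^+ 2)).
Proof.
move=> s0; split; [exact: integrable_central_power|exact: central_momentE|].
rewrite EFinD -(central_momentE m _ s0) -(integral_normal_pdf m s).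
rewrite -ge0_integralD//=; first last.
- by apply/measurable_EFinP; exact: measurable_central_power.
- by move=> x _; rewrite lee_fin mulr_ge0 ?normal_pdf_ge0// exprM sqr_ge0.
- by apply/measurable_EFinP; exact: measurable_normal_pdf.
- by move=> x _; rewrite lee_fin normal_pdf_ge0.
apply: ge0_le_integral => //=.
- apply/measurable_EFinP; apply: measurableT_comp => //.
  exact: measurable_central_power.
- apply/measurable_EFinP; apply: measurable_funD.
    exact: measurable_normal_pdf.
  exact: measurable_central_power.
- move=> x _; rewrite -EFinD lee_fin normrM (ger0_norm (normal_pdf_ge0 _ _ _)).
  rewrite -{2}(mul1r (normal_pdf m s x)) -mulrDl ler_wpM2r ?normal_pdf_ge0//.
  (* |u| <= 1 + u^2 *)
  rewrite exprM; set u := (_ ^+ n).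
  rewrite -(real_normK (num_real u)).
  by have := sqr_ge0 (`|u| - 1); have := normr_ge0 u; nra.
Qed.

End normal_moments.

(** * Integration over products with constant fiber integrals *)

Section has_integral_theory.
Context {R : realType}.

Lemma integral_probability_cst d (T : measurableType d) (P : probability T R)
  (c : R) : (\int[P]_x c%:E = c%:E)%E.
Proof.
apply: etrans (integral_cst P measurableT _) _.
by rewrite -[RHS]mule1; congr (_ * _)%E; exact: probability_setT.
Qed.

Lemma has_integralD d (T : measurableType d) (mu : {measure set T -> \bar R})
    (f g : T -> R) (a b A B : R) :
  has_integral mu f a A -> has_integral mu g b B ->
  has_integral mu (fun x => f x + g x) (a + b) (A + B).
Proof.
move=> [fi fa fA] [gi ga gB].
have fgi : mu.-integrable setT (EFin \o (fun x => f x + g x)).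
  by have := integrableD measurableT fi gi.
split => //.
- rewrite EFinD -fa -ga -integralD//.
- rewrite EFinD; apply: le_trans (leeD fA gB).
  have mf := measurable_int _ fi.
  have mg := measurable_int _ gi.
  have mnf : measurable_fun setT (fun x => `|f x|%:E).
    by apply/measurable_EFinP; apply: measurableT_comp => //; exact/measurable_EFinP.
  have mng : measurable_fun setT (fun x => `|g x|%:E).
    by apply/measurable_EFinP; apply: measurableT_comp => //; exact/measurable_EFinP.
  rewrite -ge0_integralD//=.
  apply: ge0_le_integral => //=.
  + apply/measurable_EFinP; apply: measurableT_comp => //.
    by apply/measurable_EFinP; exact: measurable_int fgi.
  + exact: emeasurable_funD.
  + by move=> x _; rewrite lee_fin ler_normD.
Qed.

Lemma has_integralZ d (T : measurableType d) (mu : {measure set T -> \bar R})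
    (f : T -> R) (a k A : R) :
  has_integral mu f a A ->
  has_integral mu (fun x => k * f x) (k * a) (`|k| * A).
Proof.
move=> [fi fa fA]; split.
- by have := integrableZl measurableT k fi.
- by rewrite EFinM -fa -integralZl.
- under eq_integral do rewrite normrM EFinM.
  rewrite ge0_integralZl//; last first.
    apply/measurable_EFinP; apply: measurableT_comp => //.
    by apply/measurable_EFinP; exact: measurable_int fi.
  by rewrite EFinM lee_wpmul2l.
Qed.

(** The integrand depends on the outer variable but its inner integral does
    not: this is how a Gaussian vector is integrated one conditional law at a
    time, the kernel being centered at a multiple of the outer variable. *)
Lemma has_integral_fiber d1 d2 (T1 : measurableType d1) (T2 : measurableType d2)
    (m1 : {sigma_finite_measure set T1 -> \bar R})
    (m2 : {sigma_finite_measure set T2 -> \bar R})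
    (u : T1 -> R) (g : T1 * T2 -> R) (a b A B : R) :
  0 <= B -> measurable_fun setT g ->
  has_integral m1 u a A ->
  (forall x, has_integral m2 (fun y => g (x, y)) b B) ->
  has_integral (m1 \x m2)%E (fun z => u z.1 * g z) (a * b) (A * B).
Proof.
move=> B0 mg [ui ua uA] gH.
have mu : measurable_fun setT u by apply/measurable_EFinP; exact: measurable_int ui.
have mf : measurable_fun setT (fun z : T1 * T2 => u z.1 * g z).
  apply: measurable_funM => //.
  exact: measurableT_comp.
have mgx x : measurable_fun setT (fun y => g (x, y)).
  by apply/measurable_EFinP; case: (gH x) => + _ _; exact: measurable_int.
have bnd : (\int[m1]_x \int[m2]_y `|(u x * g (x, y))%:E| <= (A * B)%:E)%E.
  under eq_integral => x _.
    under eq_integral do rewrite /= normrM EFinM.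
    rewrite ge0_integralZl//; last first.
      by apply/measurable_EFinP; apply: measurableT_comp (mgx x).
    over.
  apply: (@le_trans _ _ (\int[m1]_x (`|u x|%:E * B%:E))%E).
    apply: ge0_le_integral => //=.
    - by move=> x _; apply: mule_ge0 => //; exact: integral_ge0.
    - apply: emeasurable_funM.
        by apply/measurable_EFinP; exact: measurableT_comp.
      apply: (measurable_fun_fubini_tonelli_F (fun z => `|g z|%:E)) => //=.
      by apply/measurable_EFinP; exact: measurableT_comp.
    - apply: emeasurable_funM => //.
      by apply/measurable_EFinP; exact: measurableT_comp.
    - by move=> x _; apply: lee_wpmul2l => //; case: (gH x).
  rewrite ge0_integralZr//; last by apply/measurable_EFinP; exact: measurableT_comp.
  by rewrite EFinM lee_wpmul2r// lee_fin.
have fi : (m1 \x m2)%E.-integrable setT (EFin \o (fun z => u z.1 * g z)).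
  apply/integrable12ltyP; first exact/measurable_EFinP.
  by apply: le_lt_trans bnd _; rewrite ltry.
split => //.
- rewrite -(integral12_prod_meas1 fi) /fubini_F /=.
  under eq_integral => x _.
    under eq_integral do rewrite EFinM.
    have [gi gb _] := gH x.
    rewrite integralZl//; rewrite gb; over.
  by rewrite integralZr// ua -EFinM.
- rewrite fubini_tonelli1//=.
  by apply/measurable_EFinP; exact: measurableT_comp.
Qed.

End has_integral_theory.

(** * The bivariate circular Gaussian density *)

(** The density depends on the point (y0, y1) only through
    T = |y0|^2 + |y1|^2 and W = Re (y0 conj y1); with T and W fixed it is a
    function of the rate c alone. *)
Definition pair_pdf (R : realType) (T W c : R) : R :=
  expR (- ((T - 2 * expR (- c) * W) / (1 - expR (- c) ^+ 2)))
    / (pi ^+ 2 * (1 - expR (- c) ^+ 2)).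

Definition energy (R : realType) (y : C2 R) : R :=
  y.1.1 ^+ 2 + y.1.2 ^+ 2 + (y.2.1 ^+ 2 + y.2.2 ^+ 2).

Definition overlap (R : realType) (y : C2 R) : R :=
  y.1.1 * y.2.1 + y.1.2 * y.2.2.

Section density.
Context {R : realType}.

Lemma expRN_lt1 (c : R) : 0 < c -> 0 < 1 - expR (- c) ^+ 2.
Proof.
move=> c0; rewrite subr_gt0 expr_lt1// ?expR_ge0//.
by rewrite expR_lt1 oppr_lt0.
Qed.

Lemma det_cov_rho (rho : R) :
  \det (cov_rho rho) = ((1 - rho ^+ 2)%:C)%C.
Proof.
rewrite (expand_det_row _ ord0) !big_ord_recl big_ord0 /cofactor !det_mx11 !mxE /=.
rewrite expr0 expr1 !mul1r addr0 mulN1r mulrN -expr2.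
by rewrite rmorphB rmorph1 rmorphXn.
Qed.

Lemma invmx_cov_rho (rho : R) : 1 - rho ^+ 2 != 0 ->
  invmx (cov_rho rho) = (((1 - rho ^+ 2)^-1)%:C)%C *: cov_rho (- rho).
Proof.
move=> D0.
have E : cov_rho rho *m ((((1 - rho ^+ 2)^-1)%:C)%C *: cov_rho (- rho)) = 1%:M.
  apply/matrixP => i j; rewrite !mxE !big_ord_recl big_ord0 !mxE.
  case: i => [[|[|i]] hi] //; case: j => [[|[|j]] hj] //=;
    apply/eqP; rewrite eq_complex /=; apply/andP; split; apply/eqP => /=;
    by field.
by have [U _] := mulmx1_unit E; rewrite -[LHS]mulmx1 -E mulKmx.
Qed.

Lemma p_betaE (dt beta : R) (y : C2 R) : 0 < c_of dt beta ->
  p_beta dt beta y = pair_pdf (energy y) (overlap y) (c_of dt beta).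
Proof.
move=> c0; rewrite /p_beta /pair_pdf; set rho := expR (- _).
have D0 : 0 < 1 - rho ^+ 2 by exact: expRN_lt1.
rewrite /cgauss_pdf det_cov_rho /=; congr (expR (- _) / _).
rewrite invmx_cov_rho ?gt_eqF//.
rewrite !mxE !big_ord_recl big_ord0 !mxE !big_ord_recl !big_ord0 !mxE /=.
rewrite /energy /overlap.
by field; rewrite gt_eqF.
Qed.

(** Y1 - rho Y0 is independent of Y0 and has variance 1 - rho^2, and each
    complex variance is shared equally by the real and imaginary parts. *)
Lemma pair_pdf_normal (c : R) (y : C2 R) : 0 < c ->
  let s1 := Num.sqrt (2^-1) in
  let s2 := Num.sqrt ((1 - expR (- c) ^+ 2) / 2) in
  pair_pdf (energy y) (overlap y) c =
  normal_pdf 0 s1 y.1.1 * normal_pdf 0 s1 y.1.2 *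
  (normal_pdf (expR (- c) * y.1.1) s2 y.2.1 *
   normal_pdf (expR (- c) * y.1.2) s2 y.2.2).
Proof.
move=> c0 s1 s2; rewrite /pair_pdf; have := expRN_lt1 c0; rewrite /s1 /s2.
set rho := expR (- _) => D0.
have D2 : 0 < (1 - rho ^+ 2) / 2 by rewrite divr_gt0.
have h2 : 0 < 2^-1 :> R by rewrite invr_gt0.
rewrite !normal_pdfE ?gt_eqF ?sqrtr_gt0// /normal_fun /normal_peak.
rewrite !sqr_sqrtr ?ltW//.
have P := @pi_gt0 R.
set q := pi in P *.
rewrite -(mulr_natr (2^-1 * q)) -(mulr_natr (_ / 2 * q)).
rewrite -(mulr_natr 2^-1) -(mulr_natr (_ / 2)).
have -> : 2^-1 * q * 2 = q by field.
have -> : (1 - rho ^+ 2) / 2 * q * 2 = (1 - rho ^+ 2) * q by field.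
rewrite [RHS](_ : _ = ((Num.sqrt q) ^+ 2 * (Num.sqrt ((1 - rho ^+ 2) * q)) ^+ 2)^-1 *
  (expR (- (y.1.1 - 0) ^+ 2 / (2^-1 * 2)) * expR (- (y.1.2 - 0) ^+ 2 / (2^-1 * 2)) *
   (expR (- (y.2.1 - rho * y.1.1) ^+ 2 / ((1 - rho ^+ 2) / 2 * 2)) *
   expR (- (y.2.2 - rho * y.1.2) ^+ 2 / ((1 - rho ^+ 2) / 2 * 2))))); last first.
  by field; rewrite !gt_eqF// sqrtr_gt0// mulr_gt0.
rewrite !sqr_sqrtr ?mulr_ge0 ?ltW// -!expRD mulrC.
congr (_ * expR _).
  by congr (_^-1); ring.
by rewrite /energy /overlap; field; rewrite gt_eqF.
Qed.

End density.

(** * Fisher integrals of the pair law *)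

Section gaussian_polynomials.
Context {R : realType}.
Implicit Types (p q : seq (R * nat * nat)) (x w : R).

(** A polynomial in two variables is a list of terms
    ((coefficient, degree in x), degree in w).  The variables stand for one
    real coordinate x of Y0 and the same coordinate w of Y1 - rho Y0, which are
    independent, so that expectations are finite sums of products of moments. *)
Definition bp_eval p x w : R :=
  \sum_(t <- p) t.1.1 * x ^+ t.1.2 * w ^+ t.2.

Definition bp_mean v1 v2 p : R :=
  \sum_(t <- p) t.1.1 * central_moment t.1.2 v1 * central_moment t.2 v2.

Definition bp_mul p q : seq (R * nat * nat) :=
  [seq (a.1.1 * b.1.1, (a.1.2 + b.1.2)%N, (a.2 + b.2)%N) | a <- p, b <- q].

Lemma bp_eval_mul p q x w :
  bp_eval (bp_mul p q) x w = bp_eval p x w * bp_eval q x w.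
Proof.
rewrite /bp_eval big_allpairs_dep /= mulr_suml; apply: eq_bigr => a _.
rewrite mulr_sumr; apply: eq_bigr => b _; rewrite !exprD /=; ring.
Qed.

Definition bp_one : seq (R * nat * nat) := [:: (1, 0%N, 0%N)].

Lemma bp_eval1 x w : bp_eval bp_one x w = 1.
Proof. by rewrite /bp_eval big_seq1 /= !expr0 !mulr1. Qed.

Lemma has_integral_ext d (T : measurableType d) (mu : {measure set T -> \bar R})
    (f g : T -> R) (a b A : R) :
  f =1 g -> a = b -> has_integral mu f a A -> has_integral mu g b A.
Proof. by move=> /funext -> ->. Qed.

Variables (c : R) (c0 : 0 < c).
Let rho := expR (- c).
Let D := 1 - rho ^+ 2.
Let s1 : R := Num.sqrt (2^-1).
Let s2 : R := Num.sqrt (D / 2).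
Let D0 : 0 < D. Proof. exact: expRN_lt1. Qed.
Let s10 : s1 != 0. Proof. by rewrite gt_eqF// sqrtr_gt0 invr_gt0. Qed.
Let s20 : s2 != 0. Proof. by rewrite gt_eqF// sqrtr_gt0 divr_gt0. Qed.

Definition mean_c p := bp_mean 2^-1 (D / 2) p.

Lemma mean_c1 : mean_c bp_one = 1.
Proof. by rewrite /mean_c /bp_mean big_seq1 /= !mulr1. Qed.

Local Notation leb2 := (@lebesgue_C R).

Lemma has_integral_monomial (a b e f : nat) : exists B,
  has_integral (leb2 \x leb2)%E
    (fun y : C2 R => y.1.1 ^+ a * (y.2.1 - rho * y.1.1) ^+ b *
       (y.1.2 ^+ e * (y.2.2 - rho * y.1.2) ^+ f) *
       pair_pdf (energy y) (overlap y) c)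
    (central_moment a 2^-1 * central_moment b (D / 2) *
     (central_moment e 2^-1 * central_moment f (D / 2))) B.
Proof.
have v1 : s1 ^+ 2 = 2^-1 by rewrite sqr_sqrtr// invr_ge0.
have v2 : s2 ^+ 2 = D / 2 by rewrite sqr_sqrtr// divr_ge0 ?ltW.
pose B n v : R := 1 + central_moment (n * 2) v.
have B0 n v : 0 <= v -> 0 <= B n v.
  move=> vge0; rewrite addr_ge0//; elim: n => [|n IH]; first exact: ler01.
  by rewrite /= !mulr_ge0.
pose h m n s x := (x - m) ^+ n * @normal_pdf R m s x.
have mh m n s : measurable_fun setT (h m n s) by exact: measurable_central_power.
have H1 : has_integral leb2 (fun y => h 0 a s1 y.1 * h 0 e s1 y.2)
    (central_moment a 2^-1 * central_moment e 2^-1) (B a 2^-1 * B e 2^-1).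
  have F := @has_integral_fiber R _ _ _ _ (@lebesgue_measure R) (@lebesgue_measure R)
     (h 0 a s1) (fun y => h 0 e s1 y.2).
  apply: F.
  - by apply: B0; rewrite invr_ge0.
  - exact: (measurableT_comp (mh 0 e s1) measurable_snd).
  - by rewrite -v1; exact: has_integral_central_power.
  - by move=> ?; rewrite -v1; exact: has_integral_central_power.
have H2 (x : measurableTypeR R * measurableTypeR R) : has_integral leb2
    (fun y => h (rho * x.1) b s2 y.1 * h (rho * x.2) f s2 y.2)
    (central_moment b (D / 2) * central_moment f (D / 2)) (B b (D / 2) * B f (D / 2)).
  have F := @has_integral_fiber R _ _ _ _ (@lebesgue_measure R) (@lebesgue_measure R)
     (h (rho * x.1) b s2) (fun y => h (rho * x.2) f s2 y.2).
  apply: F.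
  - by apply: B0; rewrite divr_ge0 ?ltW.
  - exact: (measurableT_comp (mh _ f s2) measurable_snd).
  - by rewrite -v2; exact: has_integral_central_power.
  - by move=> ?; rewrite -v2; exact: has_integral_central_power.
exists (B a 2^-1 * B e 2^-1 * (B b (D / 2) * B f (D / 2))).
have := @has_integral_fiber _ _ _ _ _ _ _ _
   (fun y : C2 R => h (rho * y.1.1) b s2 y.2.1 * h (rho * y.1.2) f s2 y.2.2) _ _ _ _ _ _ H1 H2.
move=> H; apply: (has_integral_ext _ _ (H _ _)).
- move=> y; rewrite (pair_pdf_normal y c0) -/rho -/s1 -/s2.
  by rewrite /h !subr0; ring.
- by ring.
- by rewrite mulr_ge0// B0// divr_ge0// ltW.
(* joint measurability is visible only once the mean is moved into the
   argument of the density *)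
- have mN (g : C2 R -> R) (k : C2 R -> R) n : measurable_fun setT g -> measurable_fun setT k ->
     measurable_fun setT (fun y => h (rho * g y) n s2 (k y)).
    move=> mg mk.
    rewrite (_ : (fun _ => _) = (fun y => h 0 n s2 (k y - rho * g y))).
      apply: measurableT_comp => //; apply: measurable_funB => //.
      exact: measurable_funM.
    apply/funext => y; rewrite /h subr0; congr (_ * _).
    by rewrite !normal_pdfE// /normal_fun subr0.
  apply: measurable_funM; apply: mN.
  - exact: (measurableT_comp measurable_fst measurable_fst).
  - exact: (measurableT_comp measurable_fst measurable_snd).
  - exact: (measurableT_comp measurable_snd measurable_fst).
  - exact: (measurableT_comp measurable_snd measurable_snd).
Qed.

Lemma has_integral_bp p q : exists B,
  has_integral (leb2 \x leb2)%E
    (fun y : C2 R => bp_eval p y.1.1 (y.2.1 - rho * y.1.1) *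
                     bp_eval q y.1.2 (y.2.2 - rho * y.1.2) *
                     pair_pdf (energy y) (overlap y) c)
    (mean_c p * mean_c q) B.
Proof.
have zero : has_integral (leb2 \x leb2)%E (fun=> 0) (0 : R) (0 : R).
  split; first exact: integrable0.
    by rewrite integral0.
  by under eq_integral do rewrite normr0; rewrite integral0.
elim: p => [|t p [B1 IHp]].
  exists 0; rewrite /mean_c /bp_mean big_nil mul0r.
  by apply: has_integral_ext zero => [y|//]; rewrite /bp_eval big_nil !mul0r.
have [B2 IHt] : exists B, has_integral (leb2 \x leb2)%E
    (fun y : C2 R => bp_eval [:: t] y.1.1 (y.2.1 - rho * y.1.1) *
                     bp_eval q y.1.2 (y.2.2 - rho * y.1.2) *
                     pair_pdf (energy y) (overlap y) c)
    (mean_c [:: t] * mean_c q) B.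
  elim: q {IHp} => [|u q [B3 IHq]].
    exists 0; rewrite /mean_c /bp_mean big_nil mulr0.
    by apply: has_integral_ext zero => [y|//]; rewrite /bp_eval big_nil mulr0 mul0r.
  have [B4 H4] := has_integral_monomial t.1.2 t.2 u.1.2 u.2.
  exists (`|t.1.1 * u.1.1| * B4 + B3).
  have := has_integralD (has_integralZ (t.1.1 * u.1.1) H4) IHq.
  rewrite /mean_c /bp_mean !big_cons !big_nil !addr0.
  apply: has_integral_ext => [y|]; last by ring.
  by rewrite /bp_eval !big_cons !big_nil /=; ring.
exists (B2 + B1).
have := has_integralD IHt IHp.
rewrite /mean_c /bp_mean !big_cons !big_nil !addr0 -mulrDl.
apply: has_integral_ext => [y|//].
by rewrite /bp_eval !big_cons !big_nil /=; ring.
Qed.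

End gaussian_polynomials.
Section fisher_integrals.
Context {R : realType}.
Implicit Types T W c : R.

(** The derivative in c of ln (pair_pdf T W c); the score in beta is
    c times it. *)
Definition log_rate T W c : R :=
  let rho := expR (- c) in let D := 1 - rho ^+ 2 in
  - 2 * rho * W / D + 2 * rho ^+ 2 * (T - 2 * rho * W) / D ^+ 2
    - 2 * rho ^+ 2 / D.

(** The second derivative in c of pair_pdf T W c, divided by the density.
    In the coordinate beta, where c is exponential, the second derivative of
    the density exceeds c^2 times this one by the first, so c^2 curv_rate is
    k = (ln p)'' - q + q^2. *)
Definition curv_rate T W c : R :=
  let rho := expR (- c) in let D := 1 - rho ^+ 2 in
  log_rate T W c ^+ 2 + (2 * rho / D + 8 * rho ^+ 3 / D ^+ 2) * W
    - (4 * rho ^+ 2 / D ^+ 2 + 8 * rho ^+ 4 / D ^+ 3) * (T - 2 * rho * W)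
    + 4 * rho ^+ 2 / D ^+ 2.

Variables (c : R) (c0 : 0 < c).
Let rho := expR (- c).
Let D := 1 - rho ^+ 2.
Let D0 : D != 0. Proof. by rewrite gt_eqF// expRN_lt1. Qed.

Let qa := - 2 * rho / D.
Let qb := 2 * rho ^+ 2 / D ^+ 2.
Let qe := - rho ^+ 2 / D.

(** Logarithmic derivative of the factor of the density that belongs to the
    real (or to the imaginary) coordinates. *)
Definition log_rate_poly : seq (R * nat * nat) :=
  [:: (qa, 1%N, 1%N); (qb, 0%N, 2%N); (qe, 0%N, 0%N)].

(** Second derivative of the same factor, divided by it. *)
Definition curv_rate_poly : seq (R * nat * nat) :=
  [:: (qa ^+ 2, 2%N, 2%N); (2 * qa * qb, 1%N, 3%N); (qb ^+ 2, 0%N, 4%N);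
      (- 2 * rho ^+ 2 / D, 2%N, 0%N);
      (2 * qa * qe + 2 * rho / D + 8 * rho ^+ 3 / D ^+ 2, 1%N, 1%N);
      (2 * qb * qe - 4 * rho ^+ 2 / D ^+ 2 - 8 * rho ^+ 4 / D ^+ 3, 0%N, 2%N);
      (qe ^+ 2 + 2 * rho ^+ 2 / D ^+ 2, 0%N, 0%N)].

Lemma log_rateE (y : C2 R) :
  log_rate (energy y) (overlap y) c =
  bp_eval log_rate_poly y.1.1 (y.2.1 - rho * y.1.1) +
  bp_eval log_rate_poly y.1.2 (y.2.2 - rho * y.1.2).
Proof.
rewrite /log_rate /bp_eval !big_cons !big_nil /= /qa /qb /qe /energy /overlap.
rewrite -/rho -/D.
rewrite /D; by field.
Qed.

(** For a product of two factors,
    (f g)'' / (f g) = f'' / f + g'' / g + 2 (f' / f) (g' / g). *)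
Lemma curv_rateE (y : C2 R) :
  curv_rate (energy y) (overlap y) c =
  bp_eval curv_rate_poly y.1.1 (y.2.1 - rho * y.1.1) +
  bp_eval curv_rate_poly y.1.2 (y.2.2 - rho * y.1.2) +
  2 * (bp_eval log_rate_poly y.1.1 (y.2.1 - rho * y.1.1) *
       bp_eval log_rate_poly y.1.2 (y.2.2 - rho * y.1.2)).
Proof.
rewrite /curv_rate log_rateE.
rewrite /bp_eval !big_cons !big_nil /= /qa /qb /qe /energy /overlap.
rewrite -/rho -/D /D; by field.
Qed.

(** The first two derivatives in c of a probability density integrate to
    zero. *)
Lemma mean_log_rate : mean_c c log_rate_poly = 0.
Proof.
rewrite /mean_c /bp_mean !big_cons !big_nil /=.
rewrite /qa /qb /qe -/rho -/D.
by field.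
Qed.

Lemma mean_curv_rate : mean_c c curv_rate_poly = 0.
Proof.
rewrite /mean_c /bp_mean !big_cons !big_nil /=.
rewrite /qa /qb /qe -/rho -/D.
rewrite /D.
by field.
Qed.

Lemma mean_log_log :
  mean_c c (bp_mul log_rate_poly log_rate_poly) =
  rho ^+ 2 * (1 + rho ^+ 2) / D ^+ 2.
Proof.
rewrite /mean_c /bp_mean /bp_mul /= !big_cons !big_nil /=.
rewrite /qa /qb /qe -/rho -/D.
rewrite /D.
by field.
Qed.

Lemma mean_log_curv :
  mean_c c (bp_mul log_rate_poly curv_rate_poly) =
  - (rho ^+ 2 * (1 + rho ^+ 2) / D ^+ 2).
Proof.
rewrite /mean_c /bp_mean /bp_mul /= !big_cons !big_nil /=.
rewrite /qa /qb /qe -/rho -/D.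
rewrite /D.
by field.
Qed.

(** The subtracted term is what the product of the two logarithmic
    derivatives contributes to E k^2. *)
Lemma mean_curv_curv :
  2 * mean_c c (bp_mul curv_rate_poly curv_rate_poly) =
  2 * rho ^+ 2 * (7 * rho ^+ 6 + 19 * rho ^+ 4 + 5 * rho ^+ 2 + 1) / D ^+ 4
   - 4 * (rho ^+ 2 * (1 + rho ^+ 2) / D ^+ 2) ^+ 2.
Proof.
rewrite /mean_c /bp_mean /bp_mul /= !big_cons !big_nil /=.
rewrite /qa /qb /qe -/rho -/D.
rewrite /D.
by field.
Qed.

Local Notation pdf y := (pair_pdf (energy y) (overlap y) c).
Local Notation leb2 := (@lebesgue_C R).

(** Expand the square of the sum of the two coordinates: the cross term is a
    product of expectations, hence zero. *)
Lemma has_integral_log_log : exists B,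
  has_integral (leb2 \x leb2)%E
    (fun y : C2 R => log_rate (energy y) (overlap y) c *
                     log_rate (energy y) (overlap y) c * pdf y)
    (2 * (rho ^+ 2 * (1 + rho ^+ 2) / D ^+ 2)) B.
Proof.
pose q := log_rate_poly.
have [B1 H1] := has_integral_bp c0 (bp_mul q q) bp_one.
have [B2 H2] := has_integral_bp c0 q q.
have [B3 H3] := has_integral_bp c0 bp_one (bp_mul q q).
exists (B1 + `|2| * B2 + B3).
apply: has_integral_ext
  (has_integralD (has_integralD H1 (has_integralZ 2 H2)) H3) => [y|].
  rewrite log_rateE !bp_eval_mul !bp_eval1.
  ring.
by rewrite mean_log_rate mean_log_log mean_c1; ring.
Qed.

(** All cross terms contain the mean of one of the two coordinate
    polynomials, hence vanish. *)
Lemma has_integral_log_curv : exists B,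
  has_integral (leb2 \x leb2)%E
    (fun y : C2 R => log_rate (energy y) (overlap y) c *
                     curv_rate (energy y) (overlap y) c * pdf y)
    (- (2 * (rho ^+ 2 * (1 + rho ^+ 2) / D ^+ 2))) B.
Proof.
pose q := log_rate_poly; pose k := curv_rate_poly.
have [B1 H1] := has_integral_bp c0 (bp_mul q k) bp_one.
have [B2 H2] := has_integral_bp c0 q k.
have [B3 H3] := has_integral_bp c0 k q.
have [B4 H4] := has_integral_bp c0 bp_one (bp_mul q k).
have [B5 H5] := has_integral_bp c0 (bp_mul q q) q.
have [B6 H6] := has_integral_bp c0 q (bp_mul q q).
exists (B1 + B2 + B3 + B4 + `|2| * B5 + `|2| * B6).
apply: has_integral_ext
  (has_integralD (has_integralD (has_integralD (has_integralD
    (has_integralD H1 H2) H3) H4) (has_integralZ 2 H5)) (has_integralZ 2 H6))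
  => [y|].
  rewrite log_rateE curv_rateE !bp_eval_mul !bp_eval1.
  by rewrite -/q -/k; ring.
by rewrite mean_log_rate mean_curv_rate mean_log_curv mean_c1; ring.
Qed.

(** Of the cross terms in (k_x + k_z + 2 q_x q_z)^2 only the square of the
    last summand survives. *)
Lemma has_integral_curv_curv : exists B,
  has_integral (leb2 \x leb2)%E
    (fun y : C2 R => curv_rate (energy y) (overlap y) c *
                     curv_rate (energy y) (overlap y) c * pdf y)
    (2 * rho ^+ 2 * (7 * rho ^+ 6 + 19 * rho ^+ 4 + 5 * rho ^+ 2 + 1) / D ^+ 4)
    B.
Proof.
pose q := log_rate_poly; pose k := curv_rate_poly.
have [B1 H1] := has_integral_bp c0 (bp_mul k k) bp_one.
have [B2 H2] := has_integral_bp c0 k k.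
have [B3 H3] := has_integral_bp c0 bp_one (bp_mul k k).
have [B4 H4] := has_integral_bp c0 (bp_mul k q) q.
have [B5 H5] := has_integral_bp c0 q (bp_mul k q).
have [B6 H6] := has_integral_bp c0 (bp_mul q q) (bp_mul q q).
exists (B1 + `|2| * B2 + B3 + `|4| * B4 + `|4| * B5 + `|4| * B6).
apply: has_integral_ext
  (has_integralD (has_integralD (has_integralD (has_integralD
    (has_integralD H1 (has_integralZ 2 H2)) H3) (has_integralZ 4 H4))
    (has_integralZ 4 H5)) (has_integralZ 4 H6))
  => [y|].
  rewrite curv_rateE !bp_eval_mul !bp_eval1.
  by rewrite -/q -/k; ring.
rewrite mean_log_rate mean_curv_rate mean_log_log mean_c1.
transitivity (2 * mean_c c (bp_mul k k) +
              4 * (rho ^+ 2 * (1 + rho ^+ 2) / D ^+ 2) ^+ 2); first by ring.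
by rewrite mean_curv_curv subrK.
Qed.

End fisher_integrals.

(** * The density as a function of its rate parameter *)

Section density_derivatives.
Context {R : realType}.
Implicit Types T W c : R.

Lemma is_derive_expRN c : is_derive c 1 (fun c => expR (- c)) (- expR (- c) : R).
Proof.
have -> : (fun c : R => expR (- c)) = expR \o -%R by [].
apply: is_derive_eq (is_derive1_comp (is_derive_expR (- c)) _) _.
by rewrite mulrN1.
Qed.

Lemma is_derive_oneMexpRN c :
  is_derive c 1 (fun c => 1 - expR (- c) ^+ 2) (2 * expR (- c) ^+ 2 : R).
Proof.
have d := is_derive_expRN c.
have -> : (fun c : R => 1 - expR (- c) ^+ 2) =
   cst 1 - (fun c => expR (- c)) ^+ 2 by apply/funext => x.
by apply: is_derive_eq; rewrite ?fctE /GRing.scale /=; ring.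
Qed.

Lemma is_derive_pair_pdf T W c : 0 < c ->
  is_derive c 1 (pair_pdf T W) (log_rate T W c * pair_pdf T W c).
Proof.
move=> c0.
have D0 := expRN_lt1 c0.
have d1 := is_derive_expRN c.
have d2 := is_derive_oneMexpRN c.
have d3 := @is_deriveV R (fun c => 1 - expR (- c) ^+ 2) c _ 1 (lt0r_neq0 D0) d2.
pose Q c : R := - ((T - 2 * expR (- c) * W) * (1 - expR (- c) ^+ 2)^-1).
have dQ : is_derive c 1 Q (log_rate T W c + 2 * expR (- c) ^+ 2 / (1 - expR (- c) ^+ 2)).
  have -> : Q = - ((cst T - (2 * W) *: (fun c => expR (- c))) *
                (fun c => (1 - expR (- c) ^+ 2)^-1)).
    by apply/funext => x; rewrite /Q !fctE /GRing.scale/=; ring.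
  apply: is_derive_eq; rewrite /log_rate !fctE /GRing.scale /=.
  by field; rewrite gt_eqF.
have dE := is_derive1_comp (is_derive_expR (Q c)) dQ.
have -> : pair_pdf T W = (pi ^+ 2)^-1 *: ((expR \o Q) * (fun c => (1 - expR (- c) ^+ 2)^-1)).
  by apply/funext => x; rewrite /pair_pdf invfM !fctE /GRing.scale /=; ring.
apply: is_derive_eq; rewrite !fctE /GRing.scale /=.
have q0 : (pi : R) != 0 by rewrite gt_eqF// pi_gt0.
move: (pi : R) q0 => q q0.
by field; rewrite q0 gt_eqF.
Qed.

Lemma is_derive_log_rate T W c : 0 < c ->
  is_derive c 1 (log_rate T W) (curv_rate T W c - log_rate T W c ^+ 2).
Proof.
move=> c0.
have D0 := expRN_lt1 c0.
have d1 := is_derive_expRN c.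
have d2 := is_derive_oneMexpRN c.
have d3 := @is_deriveV R (fun c => 1 - expR (- c) ^+ 2) c _ 1 (lt0r_neq0 D0) d2.
pose r c : R := expR (- c).
pose i c : R := (1 - expR (- c) ^+ 2)^-1.
have dr : is_derive c 1 r (- r c) := d1.
have di : is_derive c 1 i (- 2 * r c ^+ 2 * i c ^+ 2).
  by apply: is_derive_eq d3 _; rewrite /GRing.scale /= /i /r exprVn; ring.
have dri : is_derive c 1 (r * i) (- (r c * i c) - 2 * r c ^+ 3 * i c ^+ 2).
  by apply: is_derive_eq; rewrite ?fctE /GRing.scale /=; ring.
have dr2i : is_derive c 1 (r * (r * i)) (- 2 * (r c ^+ 2 * i c) - 2 * r c ^+ 4 * i c ^+ 2).
  by apply: is_derive_eq; rewrite ?fctE /GRing.scale /=; ring.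
have dr2i2 : is_derive c 1 (r * i * (r * i))
    (- 2 * (r c ^+ 2 * i c ^+ 2) - 4 * r c ^+ 4 * i c ^+ 3).
  by apply: is_derive_eq; rewrite ?fctE /GRing.scale /=; ring.
have dN : is_derive c 1 (cst T - (2 * W) *: r) (2 * W * r c).
  by apply: is_derive_eq; rewrite ?fctE /GRing.scale /=; ring.
have dM := is_deriveM dr2i2 dN.
have E : log_rate T W = (- 2 * W) *: (r * i)
   + 2 *: (r * i * (r * i) * (cst T - (2 * W) *: r)) - 2 *: (r * (r * i)).
  apply/funext => x; rewrite /log_rate !fctE /GRing.scale /= /r /i -exprVn; ring.
rewrite [X in is_derive _ _ X _]E.
have dS := is_deriveB (is_deriveD (is_deriveZ (- 2 * W) dri) (is_deriveZ 2 dM))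
  (is_deriveZ 2 dr2i).
apply: is_derive_eq dS _.
rewrite !fctE /curv_rate /log_rate /GRing.scale /= /i /r.
by field; rewrite gt_eqF.
Qed.

Lemma is_derive_log_rate_pair_pdf T W c : 0 < c ->
  is_derive c 1 (fun c => log_rate T W c * pair_pdf T W c)
    (curv_rate T W c * pair_pdf T W c).
Proof.
move=> c0.
have d1 := is_derive_pair_pdf T W c0.
have d2 := is_derive_log_rate T W c0.
have -> : (fun c => log_rate T W c * pair_pdf T W c) = log_rate T W * pair_pdf T W by [].
by apply: is_derive_eq; rewrite ?fctE /GRing.scale /=; ring.
Qed.

(** The remainder has a derivative which is o(|x - x0|), as F1 is
    differentiable at x0; the mean value theorem turns this into o of the
    square. *)
Lemma taylor2_peano (F F1 : R -> R) (x0 l e : R) : 0 < e ->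
  (\forall x \near x0, is_derive (x : R) 1 F (F1 x)) -> is_derive x0 1 F1 l ->
  \forall x \near x0,
    `|F x - F x0 - F1 x0 * (x - x0) - l / 2 * (x - x0) ^+ 2|
      <= e * (x - x0) ^+ 2.
Proof.
move=> e0 dF dF1.
pose H x := F x - F x0 - F1 x0 * (x - x0) - l / 2 * (x - x0) ^+ 2.
pose H1 x := F1 x - F1 x0 - l * (x - x0).
have dH : \forall x \near x0, is_derive (x : R) 1 H (H1 x).
  near=> x.
  have d : is_derive x 1 F (F1 x) by near: x.
  have -> : H = F - cst (F x0) - F1 x0 *: (id - cst x0) - (l / 2) *: (id - cst x0) ^+ 2.
    by apply/funext => z; rewrite /H !fctE /GRing.scale.
  by apply: is_derive_eq; rewrite /H1 !fctE /GRing.scale /=; field.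
have bH : \forall x \near x0, `|H1 x| <= e * `|x - x0|.
  have : h^-1 *: ((F1 \o shift x0) (h *: 1) - F1 x0) @[h --> (0 : R)^'] --> l.
    by have [dv <-] := dF1; exact: dv.
  move=> /cvgrPdist_le /(_ _ e0) /nbhs_ballP [r /= r0 Hr].
  apply/nbhs_ballP; exists r => //= x; rewrite /ball /= => xr.
  have [->|xx0] := eqVneq x x0; first by rewrite /H1 !subrr mulr0 subr0 normr0 mulr0.
  have h0 : x - x0 != 0 by rewrite subr_eq0.
  have := Hr (x - x0); rewrite /ball /= sub0r normrN distrC => /(_ xr h0).
  rewrite /GRing.scale /= mulr1 subrK => Hx.
  have -> : H1 x = - (l - (x - x0)^-1 * (F1 x - F1 x0)) * (x - x0).
    by rewrite /H1; field.
  by rewrite normrM normrN (distrC x0) ler_wpM2r.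
have /nbhs_ballP [r /= r0 Hr] :
    \forall x \near x0, is_derive (x : R) 1 H (H1 x) /\ `|H1 x| <= e * `|x - x0|.
  exact: filterS2 dH bH.
exists r => //= x xr.
have [->|xx0] := eqVneq x x0.
  by rewrite !subrr expr0n /= !mulr0 !subr0 normr0.
have inb z : `|z - x0| <= `|x - x0| -> ball x0 r z.
  by rewrite /ball /= (distrC x0) => h; apply: le_lt_trans h _; rewrite distrC.
have cH z : `|z - x0| <= `|x - x0| -> {for z, continuous H}.
  move=> h; apply/differentiable_continuous/derivable1_diffP.
  by have [[]] := Hr z (inb z h).
have Hx0 : H x0 = 0 by rewrite /H !subrr expr0n /= !mulr0 !subr0.
have MV u v : u < v -> (forall z, u <= z <= v -> `|z - x0| <= `|x - x0|) ->
    exists2 z, u <= z <= v & H v - H u = H1 z * (v - u).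
  move=> uv huv.
  have dz z : z \in `]u, v[ -> is_derive z 1 H (H1 z).
    rewrite in_itv /= => /andP[/ltW h1 /ltW h2].
    have h3 : u <= z <= v by rewrite h1 h2.
    by case: (Hr z (inb z (huv z h3))).
  have cz : {within `[u, v], continuous H}.
    apply: continuous_in_subspaceT => z; rewrite inE /= in_itv /= => h.
    exact: cH (huv z h).
  have [z zuv E] := MVT uv dz cz.
  by exists z => //; move: zuv; rewrite in_itv /= => /andP[/ltW -> /ltW ->].
have [z zx Hz] : exists2 z, `|z - x0| <= `|x - x0| & H x = H1 z * (x - x0).
  have [lt|le] := ltP x0 x.
    have hz z : x0 <= z <= x -> `|z - x0| <= `|x - x0|.
      by move=> /andP[h1 h2]; rewrite !ger0_norm; lra.
    have [z zx E] := MV x0 x lt hz.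
    by exists z; [exact: hz|move: E; rewrite Hx0 subr0].
  have lt : x < x0 by rewrite lt_neqAle xx0.
  have hz z : x <= z <= x0 -> `|z - x0| <= `|x - x0|.
    by move=> /andP[h1 h2]; rewrite !ler0_norm; lra.
  have [z zx E] := MV x x0 lt hz.
  by exists z; [exact: hz|move: E; rewrite Hx0; lra].
rewrite -/(H x) Hz normrM -[X in _ <= e * X]real_normK ?num_real// expr2 mulrA.
rewrite ler_wpM2r//.
have [_ h] := Hr z (inb z zx).
by apply: le_trans h _; rewrite ler_wpM2l// ltW.
Unshelve. all: by end_near. Qed.

(** A local expansion of a bounded function becomes global at the price of a
    quartic term: away from 1 every power of |m - 1| below the fourth, and the
    bound itself, are dominated by a multiple of the fourth power. *)
Lemma taylor2_bounded (f : R -> R) (a b B : R) :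
  (forall m, `|f m| <= B) ->
  (forall e, 0 < e -> \forall m \near (1 : R),
    `|f m - f 1 - a * (m - 1) - b * (m - 1) ^+ 2| <= e * (m - 1) ^+ 2) ->
  forall e, 0 < e -> exists C, forall m,
    `|f m - f 1 - a * (m - 1) - b * (m - 1) ^+ 2|
      <= e * (m - 1) ^+ 2 + C * (m - 1) ^+ 4.
Proof.
move=> fB peano e e0.
have /nbhs_ballP [r /= r0 Hr] := peano e e0.
have B0 : 0 <= B by apply: le_trans (fB 0).
exists ((2 * B) / r ^+ 4 + `|a| / r ^+ 3 + `|b| / r ^+ 2) => m.
have [mr|mr] := ltP `|m - 1| r.
  apply: le_trans (Hr m _) _.
    by rewrite /ball /= distrC.
  rewrite lerDl; apply: mulr_ge0; last exact: exprn_even_ge0.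
  by rewrite !addr_ge0 ?divr_ge0 ?exprn_ge0 ?mulr_ge0 ?(ltW r0).
set u := `|m - 1| in mr.
have u0 : 0 < u by rewrite (lt_le_trans r0).
have E2 : (m - 1) ^+ 2 = u ^+ 2 by rewrite real_normK ?num_real.
have E4 : (m - 1) ^+ 4 = u ^+ 4 by rewrite (_ : 4 = 2 * 2)%N// !exprM E2.
apply: le_trans (_ : 2 * B + `|a| * u + `|b| * u ^+ 2 <= _).
  apply: (le_trans (ler_normB _ _)); rewrite normrM normrX lerD//.
  apply: (le_trans (ler_normB _ _)); rewrite normrM lerD//.
  by apply: (le_trans (ler_normB _ _)); rewrite mulr_natl mulr2n lerD.
(* u >= r, so the missing factors u^k are at least r^k *)
have P j k : (k <= 4)%N -> (j + k = 4)%N -> u ^+ j <= u ^+ 4 / r ^+ k.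
  move=> k4 jk; rewrite ler_pdivlMr ?exprn_gt0// -jk exprD ler_wpM2l ?exprn_ge0 ?(ltW u0)//.
  by rewrite lerXn2r ?nnegrE ?(ltW r0) ?(ltW u0).
rewrite E2 E4 !mulrDl ler_wpDl ?mulr_ge0 ?exprn_ge0 ?(ltW u0) ?(ltW e0)//.
have P0 := P 0%N 4%N isT erefl; have P1 := P 1%N 3%N isT erefl.
have P2 := P 2%N 2%N isT erefl.
rewrite expr0 in P0; rewrite expr1 in P1.
rewrite !(mulrAC _ _^-1) -!(mulrA _ (u ^+ 4)).
rewrite !lerD ?ler_wpM2l ?mulr_ge0//.
by rewrite ler_peMr ?mul1r.
by rewrite ler_peMr ?mul1r.
Qed.

End density_derivatives.

Section density_bounds.
Context {R : realType}.
Variables (dt : R) (dt0 : 0 < dt).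

Lemma c_of_gt0 (b : R) : 0 < c_of dt b.
Proof. by rewrite /c_of !mulr_gt0 ?expR_gt0 ?invr_gt0. Qed.

Lemma c_ofD (b m : R) : 0 < m -> c_of dt (b + ln m) = c_of dt b * m.
Proof. by move=> m0; rewrite /c_of expRD lnK ?posrE//; ring. Qed.

Lemma p_beta_gt0 (b : R) (y : C2 R) : 0 < p_beta dt b y.
Proof.
have c0 := c_of_gt0 b.
rewrite p_betaE// /pair_pdf divr_gt0 ?expR_gt0// mulr_gt0 ?expRN_lt1//.
by rewrite exprn_gt0// pi_gt0.
Qed.

Lemma is_derive_p_beta (b : R) (y : C2 R) :
  is_derive b 1 (fun b => p_beta dt b y)
    (c_of dt b * log_rate (energy y) (overlap y) (c_of dt b) * p_beta dt b y).
Proof.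
have -> : (fun b => p_beta dt b y) =
    pair_pdf (energy y) (overlap y) \o (fun b => c_of dt b).
  by apply/funext => x; rewrite /= p_betaE// c_of_gt0.
have dc : is_derive b 1 (fun b => c_of dt b) (c_of dt b).
  have -> : (fun b => c_of dt b) = (dt / 2) *: expR.
    by apply/funext => x; rewrite /c_of fctE /GRing.scale /=; ring.
  by apply: is_derive_eq; rewrite /c_of /GRing.scale /=; ring.
apply: is_derive_eq (is_derive1_comp (is_derive_pair_pdf _ _ (c_of_gt0 b)) dc) _.
by rewrite p_betaE ?c_of_gt0//; ring.
Qed.

(** As c tends to 0 the normalization 1 / (1 - rho^2) blows up, but off the
    diagonal the exponent is at most - k / (1 - rho^2) with k > 0, and
    u <= e^u. *)
Lemma p_beta_bounded (y : C2 R) : y.1.1 != y.2.1 ->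
  exists B : R, forall b, `|p_beta dt b y| <= B.
Proof.
move=> y01.
pose k : R := ((y.1.1 - y.2.1) ^+ 2 + (y.1.2 - y.2.2) ^+ 2) / 2.
have k0 : 0 < k.
  by rewrite divr_gt0// ltr_wpDr ?sqr_ge0// exprn_even_gt0//= subr_eq0.
exists ((pi ^+ 2 * k)^-1) => b.
rewrite ger0_norm ?(ltW (p_beta_gt0 _ _))//.
have c0 := c_of_gt0 b; rewrite p_betaE// /pair_pdf.
have D0 := expRN_lt1 c0.
have r0 := expR_gt0 (- c_of dt b).
have r1 : expR (- c_of dt b) < 1 by rewrite expR_lt1 oppr_lt0.
move: D0 r0 r1; set r := expR (- _); set D := 1 - _ => D0 r0 r1.
have P := @pi_gt0 R; set q := pi in P *.
have N : k <= energy y - 2 * r * overlap y.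
  rewrite /k /energy /overlap.
  move: (y.1.1) (y.1.2) (y.2.1) (y.2.2) => x z x1 z1.
  have -> : x ^+ 2 + z ^+ 2 + (x1 ^+ 2 + z1 ^+ 2) - 2 * r * (x * x1 + z * z1) =
     ((x - x1) ^+ 2 + (z - z1) ^+ 2) / 2 +
     (r * (((x - x1) ^+ 2 + (z - z1) ^+ 2) / 2) + (1 - r) * (((x + x1) ^+ 2 + (z + z1) ^+ 2) / 2)).
    by field.
  rewrite lerDl addr_ge0// mulr_ge0 ?subr_ge0 ?(ltW r0) ?(ltW r1)//;
    by rewrite divr_ge0// addr_ge0 ?sqr_ge0.
clearbody k.
rewrite (invfM _ D) (invfM _ k) mulrCA ler_wpM2l ?invr_ge0 ?exprn_ge0 ?(ltW P)//.
rewrite expRN -invfM lef_pV2 ?posrE ?mulr_gt0 ?expR_gt0//.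
rewrite -ler_pdivrMr//.
apply: le_trans (_ : k / D <= expR (k / D)) _.
  by apply: le_trans (expR_ge1Dx _); rewrite lerDr.
by rewrite ler_expR ler_wpM2r// invr_ge0 ltW.
Qed.

Lemma measurable_p_beta_ln (b : R) (y : C2 R) :
  measurable_fun [set: R] (fun m => p_beta dt (b + ln m) y).
Proof.
have h : measurable_fun [set: R] (fun b => p_beta dt b y).
  apply: continuous_measurable_fun => x.
  apply/differentiable_continuous/derivable1_diffP.
  by have [] := is_derive_p_beta x y.
by apply: (measurableT_comp h); apply: measurable_funD => //; exact: measurable_ln.
Qed.

(** Shifting beta by ln m multiplies c by m, so this is the expansion of the
    density in c, rescaled.  For m <= 0, where ln m = 0, the estimate holds by
    boundedness like everywhere far from 1. *)
Lemma p_beta_taylor (b : R) (y : C2 R) : y.1.1 != y.2.1 ->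
  let c := c_of dt b in
  let a1 := c * log_rate (energy y) (overlap y) c * p_beta dt b y in
  let a2 := c ^+ 2 * curv_rate (energy y) (overlap y) c * p_beta dt b y / 2 in
  forall e, 0 < e -> exists C, forall m,
    `|p_beta dt (b + ln m) y - p_beta dt b y - a1 * (m - 1) - a2 * (m - 1) ^+ 2|
      <= e * (m - 1) ^+ 2 + C * (m - 1) ^+ 4.
Proof.
move=> y01 c a1 a2.
have c0 : 0 < c := c_of_gt0 b.
have [B HB] := p_beta_bounded y01.
pose f (m : R) := p_beta dt (b + ln m) y.
have f1 : f 1 = p_beta dt b y by rewrite /f ln1 addr0.
suff peano (e : R) : 0 < e -> \forall m \near (1 : R),
    `|f m - f 1 - a1 * (m - 1) - a2 * (m - 1) ^+ 2| <= e * (m - 1) ^+ 2.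
  by rewrite -f1; exact: taylor2_bounded (fun m => HB _) peano.
move=> e0; rewrite f1 /f {f f1}.
have ec0 : 0 < e / c ^+ 2 by rewrite divr_gt0 ?exprn_gt0.
have near_c : \forall x \near c, 0 < x by exact: lt_nbhsr.
have := @taylor2_peano R (pair_pdf (energy y) (overlap y)) _ c _ _ ec0
  _ (is_derive_log_rate_pair_pdf (energy y) (overlap y) c0).
move=> H.
have {}H := H (ltac:(by apply: filterS near_c => x x0; exact: is_derive_pair_pdf)).
have cm : c * m @[m --> (1 : R)] --> c.
  by rewrite -[X in _ --> X]mulr1; apply: cvgM; [exact: cvg_cst|exact: cvg_id].
have Hm := cm _ H.
near=> m.
have m0 : 0 < m by near: m; exact: lt_nbhsr.
have {}H : `|pair_pdf (energy y) (overlap y) (c * m) - pair_pdf (energy y) (overlap y) c -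
     log_rate (energy y) (overlap y) c * pair_pdf (energy y) (overlap y) c * (c * m - c) -
     curv_rate (energy y) (overlap y) c * pair_pdf (energy y) (overlap y) c / 2 * (c * m - c) ^+ 2| <=
     e / c ^+ 2 * (c * m - c) ^+ 2.
  by near: m; exact: Hm.
rewrite !p_betaE ?c_of_gt0// c_ofD// -/c /a1 /a2 p_betaE// -/c.
have -> : e * (m - 1) ^+ 2 = e / c ^+ 2 * (c * m - c) ^+ 2 by field; rewrite gt_eqF.
apply: le_trans H; rewrite le_eqVlt; apply/orP; left; apply/eqP; congr `|_|.
by ring.
Unshelve. all: by end_near. Qed.

End density_bounds.

(** * Moments of the Ornstein-Uhlenbeck process *)

(** A density agrees almost everywhere with the Radon-Nikodym derivative. *)
Lemma integral_density d (T : measurableType d) (R : realType)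
    (nu : {finite_measure set T -> \bar R})
    (mu : {sigma_finite_measure set T -> \bar R}) (g f : T -> \bar R) :
  nu `<< mu -> mu.-integrable setT g ->
  (forall A, measurable A -> nu A = \int[mu]_(x in A) g x)%E ->
  measurable_fun setT f -> (forall x, 0 <= f x)%E ->
  (\int[nu]_x f x = \int[mu]_x (f x * g x))%E.
Proof.
move=> numu ig gE mf f0.
rewrite -(Radon_Nikodym_SigmaFinite.change_of_variables numu)//.
have ih := Radon_Nikodym_SigmaFinite.f_integrable numu.
apply: ae_eq_integral => //.
- by apply: emeasurable_funM => //; exact: measurable_int ih.
- by apply: emeasurable_funM => //; exact: measurable_int ig.
- apply: ae_eqe_mul2l; apply: integral_ae_eq => //; first exact: measurable_int ig.
  by move=> A _ mA; rewrite -gE// (Radon_Nikodym_SigmaFinite.f_integral numu).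
Qed.

Section gaussian_law.
Context {R : realType} {disp : measure_display} {Omega : measurableType disp}.
Variables (P : probability Omega R).

Lemma integral_normal_prob (m s : R) (f : R -> \bar R) :
  measurable_fun setT f -> (forall x, 0 <= f x)%E ->
  (\int[normal_prob m s]_x f x =
   \int[lebesgue_measure]_x (f x * (normal_pdf m s x)%:E))%E.
Proof.
move=> mf f0; apply: integral_density => //.
- exact: normal_prob_dominates.
- exact: integrable_normal_pdf.
Qed.

Lemma integral_gauss_law (m s : R) (X : Omega -> measurableTypeR R)
    (f : measurableTypeR R -> \bar R) :
  measurable_fun setT X ->
  (forall B : set R, measurable B -> P (X @^-1` B) = gauss_law m s B) ->
  measurable_fun setT f -> (forall x, 0 <= f x)%E ->
  (\int[P]_w f (X w) = if s == 0%R then f m else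
     \int[lebesgue_measure]_x (f x * (normal_pdf m s x)%:E))%E.
Proof.
move=> mX law mf f0.
have -> : (\int[P]_w f (X w) = \int[pushforward P X]_x f x)%E.
  by rewrite ge0_integral_pushforward.
rewrite /gauss_law in law; case: ifPn => s0.
  rewrite (eq_measure_integral (\d_(m : measurableTypeR R))) => [|A mA _]; last first.
    by rewrite /= /pushforward law// s0.
  by rewrite integral_dirac// diracT mul1e.
rewrite [LHS](eq_measure_integral (normal_prob m s)) => [|A mA _]; last first.
  by rewrite /= /pushforward law// (negbTE s0).
exact: integral_normal_prob.
Qed.

Lemma integral_expR_gauss_law (m s : R) (X : Omega -> R) :
  measurable_fun setT X ->
  (forall B : set R, measurable B -> P (X @^-1` B) = gauss_law m s B) ->
  (\int[P]_w (expR (X w))%:E = (expR (m + s ^+ 2 / 2))%:E)%E.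
Proof.
move=> mX law.
rewrite (@integral_gauss_law m s X (fun x => (expR x)%:E))//; last first.
  exact/measurable_EFinP.
have [->|s0] := eqVneq s 0; first by rewrite expr0n /= mul0r addr0.
under eq_integral do rewrite -EFinM -[X in expR X]mul1r.
by rewrite mgf_normal// mul1r expr1n mul1r.
Qed.

Lemma integral_sqr_gauss_law (m s x0 : R) (X : Omega -> R) :
  measurable_fun setT X ->
  (forall B : set R, measurable B -> P (X @^-1` B) = gauss_law m s B) ->
  (\int[P]_w ((X w - x0) ^+ 2)%:E = (s ^+ 2 + (m - x0) ^+ 2)%:E)%E.
Proof.
move=> mX law.
rewrite (@integral_gauss_law m s X (fun x => ((x - x0) ^+ 2)%:E))//; last 2 first.
- apply/measurable_EFinP; apply: measurable_funX; exact: measurable_funB.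
- by move=> x; rewrite lee_fin sqr_ge0.
have [->|s0] := eqVneq s 0; first by rewrite expr0n /= add0r.
have [_ H _] := has_integralD (has_integralD
  (has_integral_central_power m 2 s0)
  (has_integralZ (2 * (m - x0)) (has_integral_central_power m 1 s0)))
  (has_integralZ ((m - x0) ^+ 2) (has_integral_central_power m 0 s0)).
rewrite -[RHS](_ : (1 * s ^+ 2 * 1 + 2 * (m - x0) * 0 + (m - x0) ^+ 2 * 1)%:E = _)%E.
  rewrite -H; apply: eq_integral => x _; rewrite -EFinM; congr (_%:E); ring.
congr (_%:E); ring.
Qed.

(** The second moments about 0, 1 and -1 determine the mean and the
    variance. *)
Lemma gauss_law_moments (m s v : R) (X : Omega -> R) :
  measurable_fun setT X ->
  (forall B : set R, measurable B -> P (X @^-1` B) = gauss_law m s B) ->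
  (forall x0, \int[P]_w ((X w - x0) ^+ 2)%:E = (v + x0 ^+ 2)%:E)%E ->
  m = 0 /\ s ^+ 2 = v.
Proof.
move=> mX law H.
have e x0 : v + x0 ^+ 2 = s ^+ 2 + (m - x0) ^+ 2.
  by apply: EFin_inj; rewrite -H (integral_sqr_gauss_law _ mX law).
by have e0 := e 0; have e1 := e 1; have em := e (-1); split; nra.
Qed.

Variables (A : R) (Z : R -> Omega -> R) (OU : stationary_OU P A Z).

Lemma measurable_OU t : measurable_fun setT (Z t).
Proof.
case: OU => mZ _ _ _.
exact: (@measurable_fun_pair2 _ _ _ _ _ _ (fun x : R * Omega => Z x.1 x.2) t mZ).
Qed.

Lemma integral_OU_mul s t :
  (\int[P]_w (Z s w * Z t w)%:E = (expR (- (A * `|t - s|)))%:E)%E.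
Proof.
case: OU => _ _ E0 C; rewrite -C covariance.unlock !E0 /= unlock.
by apply: eq_integral => w _; rewrite !fctE /= !subr0.
Qed.

Lemma integrable_OU_mul s t : P.-integrable setT (fun w => (Z s w * Z t w)%:E).
Proof.
have sq u : P.-integrable setT (fun w => (Z u w * Z u w)%:E).
  apply/integrableP; split.
    by apply/measurable_EFinP; apply: measurable_funM; exact: measurable_OU.
  under eq_integral do rewrite gee0_abs ?lee_fn ?lee_fin -?expr2 ?sqr_ge0//.
  by rewrite integral_OU_mul ltry.
apply: (@le_integrable _ _ _ P setT measurableT _
   (fun w => (Z s w * Z s w)%:E + (Z t w * Z t w)%:E)%E).
- by apply/measurable_EFinP; apply: measurable_funM; exact: measurable_OU.
- move=> w _ /=; rewrite lee_fin ler_norml.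
  (* 2 |xy| <= x^2 + y^2 *)
  have := sqr_ge0 (Z s w - Z t w); have := sqr_ge0 (Z s w + Z t w).
  move: (Z s w) (Z t w) => x y h1 h2.
  rewrite [`|x * x + y * y|]ger0_norm; last by nra.
  by apply/andP; split; nra.
- exact: integrableD.
Qed.

Lemma integrable_OU t : P.-integrable setT (fun w => (Z t w)%:E).
Proof.
apply: (@le_integrable _ _ _ P setT measurableT _
   (fun w => cst 1%:E w + (Z t w * Z t w)%:E)%E).
- by apply/measurable_EFinP; exact: measurable_OU.
- move=> w _ /=; rewrite lee_fin ler_norml.
  move: (Z t w) => x.
  rewrite ger0_norm; last by nra.
  have := sqr_ge0 (x - 1); have := sqr_ge0 (x + 1).
  by move=> h1 h2; apply/andP; split; nra.
- apply: integrableD => //; last exact: integrable_OU_mul.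
  exact: finite_measure_integrable_cst.
Qed.

Lemma integral_OU t : (\int[P]_w (Z t w)%:E = 0)%E.
Proof. by case: OU => _ _ E0 _; have := E0 t; rewrite unlock. Qed.

(** A combination of two values of a Gaussian process is Gaussian, and its
    mean and variance are read off the covariance kernel. *)
Lemma mgf_OU (s t a b : R) :
  (\int[P]_w (expR (a * Z s w + b * Z t w))%:E =
   (expR ((a ^+ 2 + b ^+ 2 + 2 * a * b * expR (- (A * `|t - s|))) / 2))%:E)%E.
Proof.
pose X w := a * Z s w + b * Z t w.
have mX : measurable_fun setT X.
  by apply: measurable_funD; apply: measurable_funM => //; exact: measurable_OU.
have [m [sg law]] : exists m sg : R, forall B : set R, measurable B ->
    P (X @^-1` B) = gauss_law m sg B.
  case: OU => _ + _ _.
  move=> /(_ 2%N (fun i => if i == 0 then s else t) (fun i => if i == 0 then a else b)).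
  move=> [m [sg H]]; exists m, sg => B mB; rewrite -H//; congr (P _).
  by apply/seteqP; split=> w /=; rewrite !big_ord_recl big_ord0 addr0.
pose r := expR (- (A * `|t - s|)).
have [m0 sE] : m = 0 /\ sg ^+ 2 = a ^+ 2 + b ^+ 2 + 2 * a * b * r.
  apply: (gauss_law_moments mX law) => x0.
  have iss := integrable_OU_mul s s; have itt := integrable_OU_mul t t.
  have ist := integrable_OU_mul s t.
  have is1 := integrable_OU s; have it1 := integrable_OU t.
  have ic : P.-integrable setT (fun=> (x0 ^+ 2)%:E) by exact: finite_measure_integrable_cst.
  have Z' (k : R) (f : Omega -> R) : P.-integrable setT (fun w => (f w)%:E) ->
     P.-integrable setT (fun w => (k * f w)%:E).
    by move=> fi; under eq_fun do rewrite EFinM; exact: integrableZl.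
  have D' (f g : Omega -> R) : P.-integrable setT (fun w => (f w)%:E) ->
     P.-integrable setT (fun w => (g w)%:E) -> P.-integrable setT (fun w => (f w + g w)%:E).
    by move=> fi gi; under eq_fun do rewrite EFinD; exact: integrableD.
  have EZ (k : R) (f : Omega -> R) : P.-integrable setT (fun w => (f w)%:E) ->
     (\int[P]_w (k * f w)%:E = k%:E * \int[P]_w (f w)%:E)%E.
    by move=> fi; under eq_integral do rewrite EFinM; exact: integralZl.
  have ED (f g : Omega -> R) : P.-integrable setT (fun w => (f w)%:E) ->
     P.-integrable setT (fun w => (g w)%:E) ->
     (\int[P]_w (f w + g w)%:E = \int[P]_w (f w)%:E + \int[P]_w (g w)%:E)%E.
    by move=> fi gi; under eq_integral do rewrite EFinD; exact: integralD.
  rewrite (eq_integral (fun w => (a ^+ 2 * (Z s w * Z s w) + b ^+ 2 * (Z t w * Z t w) +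
     2 * a * b * (Z s w * Z t w) + (- 2 * x0 * a) * Z s w + (- 2 * x0 * b) * Z t w + x0 ^+ 2)%:E)%E);
     last by move=> w _; rewrite /X; congr _%:E; ring.
  have Ec := integral_probability_cst P (x0 ^+ 2).
  have i1 := Z' (a ^+ 2) _ iss; have i2 := Z' (b ^+ 2) _ itt.
  have i3 := Z' (2 * a * b) _ ist.
  have i4 := Z' (- 2 * x0 * a) _ is1; have i5 := Z' (- 2 * x0 * b) _ it1.
  have j1 := D' _ _ i1 i2; have j2 := D' _ _ j1 i3; have j3 := D' _ _ j2 i4.
  have j4 := D' _ _ j3 i5.
  rewrite (ED _ _ j4 ic) (ED _ _ j3 i5) (ED _ _ j2 i4) (ED _ _ j1 i3) (ED _ _ i1 i2).
  rewrite (EZ _ _ iss) (EZ _ _ itt) (EZ _ _ ist) (EZ _ _ is1) (EZ _ _ it1) Ec.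
  rewrite !integral_OU_mul !integral_OU !subrr normr0 mulr0 oppr0 expR0.
  by rewrite !mule0 !adde0 !mule1 -!EFinM -!EFinD.
by rewrite (integral_expR_gauss_law mX law) m0 sE add0r.
Qed.

End gaussian_law.

(** * Averages of a jointly measurable nonnegative field *)

Section field_average.
Local Open Scope ereal_scope.
Context d1 d2 (S : measurableType d1) (Omega : measurableType d2) (R : realType).
Variables (U : probability S R) (P : probability Omega R).
Variable X : S * Omega -> R.
Hypothesis mX : measurable_fun setT X.
Hypothesis X0 : forall z, (0 <= X z)%R.

(** An infinite average is read as 0.  When the field has mean 1 this affects
    only a null set, which is all that the integrals below see. *)
Definition field_average (w : Omega) : R := fine (\int[U]_s (X (s, w))%:E).

Let Ibar w := \int[U]_s (X (s, w))%:E.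

Let Ibar0 w : 0 <= Ibar w.
Proof. by apply: integral_ge0 => s _; rewrite lee_fin. Qed.

Let mXE : measurable_fun setT (fun z => (X z)%:E).
Proof. exact/measurable_EFinP. Qed.

Let mIbar : measurable_fun setT Ibar.
Proof.
apply: (measurable_fun_fubini_tonelli_G (fun z => (X z)%:E)) => //.
Qed.

Lemma measurable_field_average : measurable_fun setT field_average.
Proof. exact: measurableT_comp. Qed.

Let mXs s : measurable_fun setT (fun w => (X (s, w))%:E).
Proof. exact: (measurable_fun_pair2 s mXE). Qed.

Let mXw w : measurable_fun setT (fun s => (X (s, w))%:E).
Proof. exact: (measurable_fun_pair1 w mXE). Qed.

Hypothesis EX1 : forall s, \int[P]_w (X (s, w))%:E = 1.

Let EIbar : \int[P]_w Ibar w = 1.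
Proof.
rewrite -(fubini_tonelli (fun z => (X z)%:E))//.
by under eq_integral do rewrite EX1; exact: integral_probability_cst.
Qed.

Let Ibar_fin : {ae P, forall w, Ibar w = (field_average w)%:E}.
Proof.
have : P.-integrable setT Ibar.
  apply/integrableP; split => //.
  by under eq_integral do rewrite gee0_abs//; rewrite EIbar ltry.
move/(integrable_ae measurableT); apply: filterS => w /(_ I) h.
by rewrite fineK.
Qed.

Lemma integral_field_average : \int[P]_w (field_average w)%:E = 1.
Proof.
rewrite -EIbar; apply: ae_eq_integral => //.
- by apply/measurable_EFinP; exact: measurable_field_average.
- by apply: filterS Ibar_fin => w + _ => ->.
Qed.

(** The square of an average is a double average, to which Tonelli's theorem
    is applied one variable at a time. *)
Lemma integral_field_average_sqr (K : S -> S -> R) :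
  (forall s t, \int[P]_w (X (s, w) * X (t, w))%:E = (K s t)%:E) ->
  \int[P]_w (field_average w ^+ 2)%:E = \int[U]_s \int[U]_t (K s t)%:E.
Proof.
move=> EK.
transitivity (\int[P]_w (Ibar w * Ibar w)).
  apply: ae_eq_integral => //.
  - apply/measurable_EFinP/measurable_funX; exact: measurable_field_average.
  - exact: emeasurable_funM.
  - by apply: filterS Ibar_fin => w + _ => ->; rewrite -EFinM.
pose F (z : S * Omega) : \bar R := (X z)%:E * Ibar z.2.
have F0 z : 0 <= F z by rewrite mule_ge0// lee_fin.
have mF : measurable_fun setT F.
  by apply: emeasurable_funM => //; exact: measurableT_comp.
transitivity (\int[P]_w \int[U]_s F (s, w)).
  apply: eq_integral => w _; rewrite /F /= ge0_integralZr//.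
  by move=> s _; rewrite lee_fin.
rewrite -(fubini_tonelli F)//; apply: eq_integral => s _.
pose G (z : S * Omega) : \bar R := (X (s, z.2) * X z)%:E.
have G0 z : 0 <= G z by rewrite lee_fin mulr_ge0.
have mG : measurable_fun setT G.
  apply/measurable_EFinP; apply: measurable_funM => //.
  apply: (measurableT_comp (f := fun w => X (s, w))) => //.
  exact: (measurable_fun_pair2 s mX).
transitivity (\int[P]_w \int[U]_t G (t, w)).
  apply: eq_integral => w _; rewrite /F /G /= -ge0_integralZl//.
  - by move=> t _; rewrite lee_fin.
  - by rewrite lee_fin.
by rewrite -(fubini_tonelli G)//; apply: eq_integral => t _; rewrite -EK.
Qed.

Let jensen4 w : Ibar w = (field_average w)%:E ->
  ((field_average w - 1) ^+ 4)%:E <= \int[U]_s ((X (s, w) - 1) ^+ 4)%:E.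
Proof.
move=> If; set m := field_average w in If *.
have iX : U.-integrable setT (fun s => (X (s, w))%:E).
  apply/integrableP; split => //.
  by under eq_integral do rewrite gee0_abs ?lee_fin//; rewrite -/(Ibar w) If ltry.
have ic (c : R) : U.-integrable setT (fun=> c%:E) by exact: finite_measure_integrable_cst.
have Ic := integral_probability_cst U.
have m4 : measurable_fun setT (fun s => ((X (s, w) - 1) ^+ 4)%:E).
  apply/measurable_EFinP/measurable_funX/measurable_funB => //.
  exact: (measurable_fun_pair1 w mX).
have [i4|] := pselect (U.-integrable setT (fun s => ((X (s, w) - 1) ^+ 4)%:E)); last first.
  move=> ni; suff -> : \int[U]_s ((X (s, w) - 1) ^+ 4)%:E = +oo by rewrite leey.
  apply: contrapT => ne; apply: ni; apply/integrableP; split => //.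
  under eq_integral do rewrite gee0_abs ?lee_fin ?exprn_even_ge0//.
  by rewrite ltey; apply/eqP.
(* x |-> (x - 1)^4 lies above its tangent at m, whose mean is its value at m *)
pose tangent s : R := ((m - 1) ^+ 4 - 4 * (m - 1) ^+ 3 * m + 4 * (m - 1) ^+ 3 * X (s, w))%R.
have E : \int[U]_s (tangent s)%:E = ((m - 1) ^+ 4)%:E.
  under eq_integral do rewrite EFinD EFinM.
  rewrite integralD//; last exact: integrableZl.
  rewrite Ic integralZl// -/(Ibar w) If -EFinM -EFinD; congr (_%:E); ring.
rewrite -E; apply: le_integral => //.
  rewrite /tangent; under eq_fun do rewrite EFinD EFinM.
  by apply: integrableD => //; exact: integrableZl.
move=> s _; rewrite lee_fin /tangent.
move: (X (s, w)) m {E tangent If} => u m.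
rewrite -subr_ge0 [X in (0 <= X)%R](_ : _ =
  ((u - m) ^+ 2 * (2 * (m - 1) ^+ 2 + ((u - 1) + (m - 1)) ^+ 2))%R); last by ring.
apply: mulr_ge0; first exact: sqr_ge0.
by apply: addr_ge0; [apply: mulr_ge0 => //; exact: sqr_ge0|exact: sqr_ge0].
Qed.

(** Jensen's inequality for the average in s, then Tonelli's theorem. *)
Lemma integral_field_average_pow4 (k4 : R) :
  (forall s, \int[P]_w ((X (s, w) - 1) ^+ 4)%:E = k4%:E) ->
  \int[P]_w ((field_average w - 1) ^+ 4)%:E <= k4%:E.
Proof.
move=> E4.
pose F (z : S * Omega) : \bar R := ((X z - 1) ^+ 4)%:E.
have F0 z : 0 <= F z by rewrite lee_fin exprn_even_ge0.
have mF : measurable_fun setT F.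
  by apply/measurable_EFinP/measurable_funX/measurable_funB.
apply: (@le_trans _ _ (\int[P]_w \int[U]_s F (s, w))).
  apply: ae_ge0_le_integral => //.
  - by move=> w _; rewrite lee_fin exprn_even_ge0.
  - apply/measurable_EFinP/measurable_funX/measurable_funB => //.
    exact: measurable_field_average.
  - by move=> w _; exact: integral_ge0.
  - exact: (measurable_fun_fubini_tonelli_G F).
  - by apply: filterS Ibar_fin => w h _; exact: jensen4.
rewrite -(fubini_tonelli F)//; under eq_integral do rewrite E4.
by rewrite integral_probability_cst.
Qed.

End field_average.

(** * Second-order expansion of an expectation *)

Section expectation_taylor.
Context d (Omega : measurableType d) (R : realType) (P : probability Omega R).

(** Take expectations in the expansion of f at 1: the linear term vanishes
    since M has mean 1, and the quadratic one gives the variance v. *)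
Lemma expectation_taylor2 (M : Omega -> R) (f : R -> R) (f1 a b B e C v k4 : R) :
  measurable_fun setT M -> measurable_fun setT f ->
  (forall w, 0 <= M w) ->
  (forall m, `|f m| <= B) -> 0 <= C ->
  (forall m, `|f m - f1 - a * (m - 1) - b * (m - 1) ^+ 2|
      <= e * (m - 1) ^+ 2 + C * (m - 1) ^+ 4) ->
  (\int[P]_w (M w)%:E = 1)%E ->
  (\int[P]_w (M w ^+ 2)%:E = (1 + v)%:E)%E ->
  (\int[P]_w ((M w - 1) ^+ 4)%:E <= k4%:E)%E ->
  `|\int[P]_w f (M w) - f1 - b * v| <= e * v + C * k4.
Proof.
move=> mM mf M0 fB C0 bnd E1 E2 E4.
have ic (c : R) : P.-integrable setT (EFin \o (fun=> c)) by exact: finite_measure_integrable_cst.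
have Ic := integral_probability_cst P.
have H0 (c : R) : has_integral P (fun=> c) c `|c|.
  by split; [exact: ic|exact: Ic|rewrite Ic].
have H1 : has_integral P M 1 1.
  split=> //.
    apply/integrableP; split; first exact/measurable_EFinP.
    by under eq_integral do rewrite /= ger0_norm//; rewrite E1 ltry.
  by under eq_integral do rewrite ger0_norm//; rewrite E1.
have H2 : has_integral P (fun w => M w ^+ 2) (1 + v) (1 + v).
  split=> //.
    apply/integrableP; split; first by apply/measurable_EFinP/measurable_funX.
    by under eq_integral do rewrite /= ger0_norm ?sqr_ge0//; rewrite E2 ltry.
  by under eq_integral do rewrite ger0_norm ?sqr_ge0//; rewrite E2.
have H4i : P.-integrable setT (EFin \o (fun w => (M w - 1) ^+ 4)).
  apply/integrableP; split; first by apply/measurable_EFinP/measurable_funX/measurable_funB.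
  under eq_integral do rewrite /= ger0_norm ?exprn_even_ge0//.
  by apply: le_lt_trans E4 _; rewrite ltry.
have Hf : P.-integrable setT (EFin \o (fun w => f (M w))).
  apply: (@le_integrable _ _ _ P setT measurableT _ (fun=> B%:E)).
  - by apply/measurable_EFinP; exact: measurableT_comp.
  - by move=> w _; rewrite lee_fin (le_trans (fB _))// ler_norm.
  - exact: ic.
have Hff : has_integral P (fun w => f (M w)) (\int[P]_w f (M w)) B.
  split=> //.
    by rewrite /Rintegral fineK//; exact: integrable_fin_num Hf.
  apply: (@le_trans _ _ (\int[P]_w B%:E)%E); last by rewrite Ic.
  apply: ge0_le_integral => //.
  - by apply/measurable_EFinP; apply: measurableT_comp => //; exact: measurableT_comp.
  - by move=> w _; rewrite lee_fin.
pose h w := f (M w) - f1 - a * (M w - 1) - b * (M w - 1) ^+ 2.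
have [? [hi hE _]] : exists A, has_integral P h (\int[P]_w f (M w) - f1 - b * v) A.
  eexists; apply: has_integral_ext (has_integralD (has_integralD (has_integralD Hff (H0 (a - f1 - b)))
     (has_integralZ (2 * b - a) H1)) (has_integralZ (- b) H2)) => [w|]; last by ring.
  by rewrite /h; ring.
have [? [gi gE _]] : exists A, has_integral P (fun w => (M w - 1) ^+ 2) v A.
  eexists; apply: has_integral_ext (has_integralD (has_integralD H2 (has_integralZ (- 2) H1)) (H0 1))
    => [w|]; by ring.
rewrite -lee_fin.
have -> : (`|\int[P]_w f (M w) - f1 - b * v|%:E = `|\int[P]_w (h w)%:E|)%E by rewrite hE.
apply: le_trans (le_abse_integral _ _ _) _ => //; first exact: measurable_int hi.
apply: (@le_trans _ _ (\int[P]_w (e%:E * ((M w - 1) ^+ 2)%:E + C%:E * ((M w - 1) ^+ 4)%:E))%E).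
  apply: le_integral => //.
  - exact: integrable_abse.
  - by apply: integrableD => //; apply: integrableZl.
  - by move=> w _; rewrite /= -!EFinM -EFinD lee_fin; exact: bnd.
rewrite integralD//; [|exact: integrableZl|exact: integrableZl].
rewrite !integralZl// gE EFinD EFinM leeD2l// EFinM.
by rewrite lee_wpmul2l.
Qed.

End expectation_taylor.

Section exp_kernel.
Context d (S : measurableType d) (R : realType) (U : probability S R).

(** For 0 <= u <= 1 and x >= 0, x u <= e^(xu) - 1 <= x u e^x.  Bounding the
    exponential from both sides by affine functions of the kernel avoids any
    differentiation under the integral. *)
Lemma exp_kernel_bounds (r : S * S -> R) (V x : R) :
  measurable_fun setT r -> (forall z, 0 <= r z <= 1) ->
  (\int[U]_s \int[U]_t (r (s, t))%:E = V%:E)%E -> 0 <= x ->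
  exists v, (\int[U]_s \int[U]_t (expR (x * r (s, t)))%:E = (1 + v)%:E)%E /\
    x * V <= v <= x * expR x * V.
Proof.
move=> mr r01 rV x0.
have r0 z : 0 <= r z by case/andP: (r01 z).
have mono (f g : S * S -> \bar R) :
    measurable_fun setT f -> measurable_fun setT g ->
    (forall z, 0 <= f z)%E -> (forall z, f z <= g z)%E ->
    (\int[U]_s \int[U]_t f (s, t) <= \int[U]_s \int[U]_t g (s, t))%E.
  move=> mf mg f0 fg.
  have g0 z : (0 <= g z)%E by exact: le_trans (fg z).
  apply: ge0_le_integral => //.
  - by move=> s _; exact: integral_ge0.
  - exact: (measurable_fun_fubini_tonelli_F f).
  - exact: (measurable_fun_fubini_tonelli_F g).
  move=> s _; apply: ge0_le_integral => //.
  - exact: (measurable_fun_pair2 s mf).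
  - exact: (measurable_fun_pair2 s mg).
pose F (z : S * S) : \bar R := (r z)%:E.
have F0 z : (0 <= F z)%E by rewrite lee_fin.
have mF : measurable_fun setT F by exact/measurable_EFinP.
have aff (k : R) : 0 <= k ->
   (\int[U]_s \int[U]_t (1 + k * r (s, t))%:E = (1 + k * V)%:E)%E.
  move=> k0.
  have int1 := integral_probability_cst U 1.
  have mFs s : measurable_fun setT (fun t => F (s, t)) by exact: (measurable_fun_pair2 s mF).
  rewrite (eq_integral (fun s => 1 + k%:E * \int[U]_t F (s, t))%E) => [|s _]; last first.
    under eq_integral do rewrite EFinD EFinM.
    rewrite ge0_integralD//; last 2 first.
    - by move=> t _; rewrite mule_ge0// lee_fin.
    - by apply: measurable_funeM; exact: mFs.
    rewrite int1 ge0_integralZl//; first exact: mFs.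
    by move=> t _; rewrite lee_fin.
  have mG : measurable_fun setT (fun s => \int[U]_t F (s, t))%E.
    exact: (measurable_fun_fubini_tonelli_F F).
  have G0 s : (0 <= \int[U]_t F (s, t))%E by exact: integral_ge0.
  rewrite ge0_integralD//; last 2 first.
  - by move=> s _; rewrite mule_ge0.
  - exact: measurable_funeM.
  by rewrite int1 ge0_integralZl// rV EFinD EFinM.
pose K (z : S * S) : \bar R := (expR (x * r z))%:E.
have mK : measurable_fun setT K.
  apply/measurable_EFinP; apply: measurableT_comp => //.
  exact: measurable_funM.
have maff (k : R) : measurable_fun setT (fun z => (1 + k * r z)%:E).
  by apply/measurable_EFinP; apply: measurable_funD => //; exact: measurable_funM.
have lo : ((1 + x * V)%:E <= \int[U]_s \int[U]_t K (s, t))%E.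
  rewrite -(aff x x0); apply: (mono (fun z => (1 + x * r z)%:E) K) => // z.
    by rewrite lee_fin addr_ge0 ?mulr_ge0.
  by rewrite lee_fin expR_ge1Dx.
have hi : (\int[U]_s \int[U]_t K (s, t) <= (1 + x * expR x * V)%:E)%E.
  have k0 : 0 <= x * expR x by rewrite mulr_ge0 ?expR_ge0.
  rewrite -(aff _ k0).
  apply: (mono K (fun z => (1 + x * expR x * r z)%:E)) => // z.
    by rewrite lee_fin expR_ge0.
  have /andP[h0 h1] := r01 z; rewrite lee_fin.
  set u := r z in h0 h1 *.
  have xu : x * u <= x by rewrite ler_piMr.
  have e1 : expR (x * u) <= 1 + x * u * expR (x * u).
    have := expR_ge1Dx (- (x * u)); rewrite expRN => h.
    have e0 := expR_gt0 (x * u).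
    have : (1 - x * u) * expR (x * u) <= 1 by rewrite -ler_pdivlMr// mul1r.
    by rewrite mulrBl mul1r lerBlDr.
  apply: le_trans e1 _; rewrite lerD2l mulrAC ler_wpM2r//.
  by rewrite ler_wpM2l// ler_expR.
move: lo hi; rewrite /K; set E := (\int[U]_s _)%E => lo hi.
have Ef : E \is a fin_num.
  rewrite fin_numE; apply/andP; split.
    by rewrite gt_eqF// (lt_le_trans _ lo)// ltNyr.
  by rewrite lt_eqF// (le_lt_trans hi)// ltry.
exists (fine E - 1); split; first by rewrite subrKC fineK.
by rewrite -(fineK Ef) !lee_fin in lo hi; apply/andP; split; lra.
Qed.

End exp_kernel.

(** * The time average of the exponential field *)

Section kernel_mean.
Context {R : realType}.
Variables (A dt : R) (A0 : 0 < A) (dt0 : 0 < dt).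
Local Notation mu := (@lebesgue_measure R).

Lemma Vfun_gt0 (d : R) : 0 < d -> 0 < Vfun d.
Proof.
move=> d0; rewrite /Vfun divr_gt0 ?exprn_gt0// mulr_gt0//.
have : 1 + - d < expR (- d) by apply: expR_gt1Dx; rewrite oppr_eq0 gt_eqF.
lra.
Qed.

Lemma is_derive_expR_affine (k l x : R) :
  is_derive (x : R) 1 (fun x : R => expR (k * x + l)) (k * expR (k * x + l)).
Proof.
have d : is_derive (x : R) 1 (fun x : R => k * x + l) k.
  have -> : (fun x : R => k * x + l) = k *: id + cst l by [].
  by apply: is_derive_eq; rewrite addr0 /GRing.scale /= mulr1.
have -> : (fun x0 : R => expR (k * x0 + l)) = expR \o (fun x : R => k * x + l) by [].
rewrite [X in is_derive _ _ _ X]mulrC.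
exact: (@is_derive1_comp R expR (fun x : R => k * x + l) x _ _ (is_derive_expR _) d).
Qed.

Lemma continuous_expR_affine (k l : R) : continuous (fun x : R => expR (k * x + l)).
Proof.
move=> x; apply/differentiable_continuous/derivable1_diffP.
by case: (is_derive_expR_affine k l x).
Qed.

Lemma inner_kernel_integral (s : R) : 0 < s < dt ->
  (\int[mu]_(t in `[(0%R : R), dt]) (expR (- (A * `|t - s|)))%:E =
   ((2 - expR (- A * s) - expR (A * s - A * dt)) / A)%:E)%E.
Proof.
move=> /andP[s0 sdt].
have mf : measurable_fun [set: R] (fun t => (expR (- (A * `|t - s|)))%:E).
  apply/measurable_EFinP; apply: measurableT_comp => //.
  apply: measurableT_comp => //; apply: measurable_funM => //.
  by apply: measurableT_comp => //; exact: measurable_funB.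
rewrite (@itv_bndbnd_setU _ _ _ (BRight s))//; last 2 first.
- by rewrite bnd_simp ltW.
- by rewrite bnd_simp ltW.
rewrite ge0_integral_setU//=; last 2 first.
- exact: measurable_funTS.
- apply/disj_setPS => x [] /=; rewrite !in_itv /= => /andP[_ h1] /andP[h2 _].
  by move: (lt_le_trans h2 h1); rewrite ltxx.
rewrite [in X in (_ + X)%E]integral_itv_obnd_cbnd; last first.
  exact: measurable_funTS.
rewrite [X in (X + _)%E](eq_integral (fun t : measurableTypeR R => (expR (A * t + (- (A * s))))%:E));
  last first.
  move=> t; rewrite inE /= in_itv /= => /andP[_ ts]; congr (expR _)%:E.
  by rewrite ler0_norm ?subr_le0//; ring.
rewrite [X in (_ + X)%E](eq_integral (fun t : measurableTypeR R => (expR (- A * t + A * s))%:E));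
  last first.
  move=> t; rewrite inE /= in_itv /= => /andP[st _]; congr (expR _)%:E.
  by rewrite ger0_norm ?subr_ge0//; ring.
have dF1 (x : R) : is_derive (x : R) 1 (fun t : R => A^-1 * expR (A * t + - (A * s)))
    (expR (A * x + - (A * s))).
  have -> : (fun t : R => A^-1 * expR (A * t + - (A * s))) =
    A^-1 *: (fun t : R => expR (A * t + - (A * s))) by [].
  apply: is_derive_eq (is_deriveZ A^-1 (is_derive_expR_affine A (- (A * s)) x)) _.
  by rewrite /GRing.scale /= mulKf// gt_eqF.
have dF2 (x : R) : is_derive (x : R) 1 (fun t : R => - A^-1 * expR (- A * t + A * s))
    (expR (- A * x + A * s)).
  have -> : (fun t : R => - A^-1 * expR (- A * t + A * s)) =
    - A^-1 *: (fun t : R => expR (- A * t + A * s)) by [].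
  apply: is_derive_eq (is_deriveZ (- A^-1) (is_derive_expR_affine (- A) (A * s) x)) _.
  by rewrite /GRing.scale /= mulrA mulrNN mulVf ?mul1r// gt_eqF.
rewrite (integral_FTC s0 dF1 (@continuous_expR_affine A (- (A * s)))).
rewrite (integral_FTC sdt dF2 (@continuous_expR_affine (- A) (A * s))).
rewrite -EFinD; congr (_%:E).
have -> : A * s - A * s = 0 by ring.
have -> : A * 0 - A * s = - A * s by ring.
have -> : - A * s + A * s = 0 by ring.
have -> : - A * dt + A * s = A * s - A * dt by ring.
by rewrite expR0; field; rewrite gt_eqF.
Qed.

(** V(A dt) is the mean of the covariance of the process over the square
    [0, dt]^2. *)
Lemma kernel_mean :
  (\int[uniform_prob dt0]_s \int[uniform_prob dt0]_t
      (expR (- (A * `|t - s|)))%:E = (Vfun (A * dt))%:E)%E.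
Proof.
pose f (s : R) : R := (2 - expR (- A * s + 0) - expR (A * s - A * dt)) / (A * dt).
have cf : continuous f.
  move=> x; apply: cvgM; last exact: cvg_cst.
  apply: cvgB; last exact: continuous_expR_affine.
  by apply: cvgB; [exact: cvg_cst|exact: continuous_expR_affine].
pose k (z : measurableTypeR R * measurableTypeR R) : \bar R := (expR (- (A * `|z.2 - z.1|)))%:E.
have mk : measurable_fun setT k.
  apply/measurable_EFinP; apply: measurableT_comp => //.
  apply: measurableT_comp => //; apply: measurable_funM => //.
  apply: measurableT_comp => //; apply: measurable_funB => //.
have k0 z : (0 <= k z)%E by rewrite lee_fin expR_ge0.
have mF : measurable_fun setT (fun s => \int[uniform_prob dt0]_t k (s, t))%E.
  exact: (measurable_fun_fubini_tonelli_F k).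
rewrite (@integral_uniform _ _ _ dt0 (fun s => \int[uniform_prob dt0]_t k (s, t))%E)//; last first.
  by move=> s; exact: integral_ge0.
(* the formula for the inner integral splits [0, dt] at an interior point s *)
rewrite integral_itv_bndoo; last exact: measurable_funTS.
rewrite (eq_integral (fun s : measurableTypeR R =>
   ((2 - expR (- A * s + 0) - expR (A * s - A * dt)) / (A * dt))%:E)); last first.
  move=> s; rewrite inE /= in_itv /= => sdt.
  rewrite integral_uniform//; last exact: (measurable_fun_pair2 s mk).
  rewrite /k /= inner_kernel_integral// -EFinM subr0 addr0; congr (_%:E).
  by field; rewrite !gt_eqF.
rewrite -(@integral_itv_bndoo _ _ _ _ true false); last first.
  by apply/measurable_EFinP/measurable_funTS; exact: continuous_measurable_fun cf.
pose F (s : R) : R :=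
  (A * dt)^-1 * (2 * s + A^-1 * expR (- A * s + 0) - A^-1 * expR (A * s + - (A * dt))).
have dF (x : R) : is_derive (x : R) 1 F (f x).
  have d1 := is_derive_expR_affine (- A) 0 x.
  have d2 := is_derive_expR_affine A (- (A * dt)) x.
  have dS := is_deriveZ (A * dt)^-1 (is_deriveB (is_deriveD
    (is_deriveZ 2 (is_derive_id x (1 : R))) (is_deriveZ A^-1 d1)) (is_deriveZ A^-1 d2)).
  apply: is_derive_eq dS _; rewrite /f /GRing.scale /=.
  by field; rewrite !gt_eqF.
rewrite (integral_FTC dt0 dF cf).
rewrite -EFinM /F /Vfun subr0 !mulr0 !add0r !addr0 expR0 mulNr subrr expR0.
by congr (_%:E); field; rewrite !gt_eqF.
Qed.

End kernel_mean.

Section time_average.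
Context {R : realType} {disp : measure_display} {Omega : measurableType disp}.
Variables (P : probability Omega R) (A dt : R) (Z : R -> Omega -> R).
Hypotheses (A0 : 0 < A) (dt0 : 0 < dt) (OU : stationary_OU P A Z).

Definition exp_field (l : R) (z : measurableTypeR R * Omega) : R :=
  expR (l * Z z.1 z.2 - l ^+ 2 / 2).

Definition exp_average (l : R) : Omega -> R :=
  field_average (uniform_prob dt0) (exp_field l).

Lemma measurable_exp_field l : measurable_fun setT (exp_field l).
Proof.
case: OU => mZ _ _ _.
apply: measurableT_comp => //; apply: measurable_funB => //.
by apply: measurable_funM => //; exact: mZ.
Qed.

Let exp_field0 l z : 0 <= exp_field l z.
Proof. exact: expR_ge0. Qed.

Lemma measurable_exp_average l : measurable_fun setT (exp_average l).
Proof. apply: measurable_field_average => //; exact: measurable_exp_field. Qed.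

Lemma exp_average_ge0 l w : 0 <= exp_average l w.
Proof. by rewrite fine_ge0// integral_ge0// => s _; rewrite lee_fin. Qed.

Lemma delta_exp_average l w : delta dt Z l w = ln (exp_average l w).
Proof.
rewrite /delta /exp_average /field_average integral_uniform; first last.
- by move=> s; rewrite lee_fin expR_ge0.
- apply/measurable_EFinP.
  exact: (measurable_fun_pair1 w (measurable_exp_field l)).
rewrite subr0 /Rintegral; congr ln.
set I := (\int[_]_(x in _) _)%E.
have : (0 <= I)%E by apply: integral_ge0 => s _; rewrite lee_fin expR_ge0.
(* an infinite time integral is read as 0 on both sides *)
case: I => [r _| _|//]; first by [].
by rewrite mulr0 gt0_muley// lte_fin invr_gt0.
Qed.

Lemma integral_expR_OU (s t a b c : R) :
  (\int[P]_w (expR (a * Z s w + b * Z t w + c))%:E =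
   (expR ((a ^+ 2 + b ^+ 2 + 2 * a * b * expR (- (A * `|t - s|))) / 2 + c))%:E)%E.
Proof.
under eq_integral do rewrite expRD EFinM.
rewrite ge0_integralZr//; first last.
- apply/measurable_EFinP; apply: measurableT_comp => //.
  by apply: measurable_funD; apply: measurable_funM => //; exact: (measurable_OU OU).
by rewrite (mgf_OU OU) -EFinM -expRD.
Qed.

Lemma integral_exp_field l s : (\int[P]_w (exp_field l (s, w))%:E = 1)%E.
Proof.
rewrite (eq_integral (fun w => (expR (l * Z s w + 0 * Z s w + - (l ^+ 2 / 2)))%:E)).
  rewrite integral_expR_OU -[RHS]/(1%:E); congr (_%:E).
  by rewrite -[RHS]expR0; congr expR; field.
by move=> w _; rewrite /exp_field /= mul0r addr0.
Qed.

Lemma integral_exp_field_mul l s t :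
  (\int[P]_w (exp_field l (s, w) * exp_field l (t, w))%:E =
   (expR (l ^+ 2 * expR (- (A * `|t - s|))))%:E)%E.
Proof.
rewrite (eq_integral (fun w => (expR (l * Z s w + l * Z t w + - l ^+ 2))%:E)).
  by rewrite integral_expR_OU; congr (expR _)%:E; field.
by move=> w _; rewrite /exp_field /= -expRD; congr (expR _)%:E; field.
Qed.

(** E (e^(lZ - l^2/2) - 1)^4 for a standard normal Z, as a function of
    x = l^2. *)
Definition fourth_moment (x : R) : R :=
  expR (6 * x) - 4 * expR (3 * x) + 6 * expR x - 3.

Lemma integral_exp_field_pow4 l s :
  (\int[P]_w ((exp_field l (s, w) - 1) ^+ 4)%:E = (fourth_moment (l ^+ 2))%:E)%E.
Proof.
(* the j-th moment is exp ((j^2 - j) l^2 / 2) *)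
have Hj (j : nat) : has_integral P (fun w => exp_field l (s, w) ^+ j)
    (expR ((j%:R ^+ 2 - j%:R) * l ^+ 2 / 2)) (expR ((j%:R ^+ 2 - j%:R) * l ^+ 2 / 2)).
  have m : measurable_fun setT (fun w => exp_field l (s, w) ^+ j).
    apply: measurable_funX.
    exact: (measurable_fun_pair2 s (measurable_exp_field l)).
  have E : (\int[P]_w (exp_field l (s, w) ^+ j)%:E = (expR ((j%:R ^+ 2 - j%:R) * l ^+ 2 / 2))%:E)%E.
    rewrite (eq_integral (fun w => (expR (j%:R * l * Z s w + 0 * Z s w + - (j%:R * (l ^+ 2 / 2))))%:E)).
      by rewrite integral_expR_OU; congr (expR _)%:E; field.
    move=> w _; rewrite /exp_field /= -expRM_natl; congr (expR _)%:E; ring.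
  have p w : 0 <= exp_field l (s, w) ^+ j by rewrite exprn_ge0.
  split=> //.
    apply/integrableP; split; first exact/measurable_EFinP.
    by under eq_integral do rewrite /= ger0_norm//; rewrite E ltry.
  by under eq_integral do rewrite ger0_norm//; rewrite E.
have [_ H _] := has_integralD (has_integralD (has_integralD (has_integralD
  (Hj 4%N) (has_integralZ (- 4) (Hj 3%N))) (has_integralZ 6 (Hj 2%N)))
  (has_integralZ (- 4) (Hj 1%N))) (Hj 0%N).
rewrite (eq_integral (fun w => (exp_field l (s, w) ^+ 4 + - 4 * exp_field l (s, w) ^+ 3 +
    6 * exp_field l (s, w) ^+ 2 + - 4 * exp_field l (s, w) ^+ 1 + exp_field l (s, w) ^+ 0)%:E));
  last by move=> w _; congr (_%:E); ring.
rewrite H /fourth_moment; congr (_%:E).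
have -> : (4 ^+ 2 - 4) * l ^+ 2 / 2 = 6 * l ^+ 2 by field.
have -> : (3 ^+ 2 - 3) * l ^+ 2 / 2 = 3 * l ^+ 2 by field.
have -> : (2 ^+ 2 - 2) * l ^+ 2 / 2 = l ^+ 2 by field.
have -> : (1 ^+ 2 - 1) * l ^+ 2 / 2 = 0 by field.
have -> : (0 ^+ 2 - 0) * l ^+ 2 / 2 = 0 by field.
by rewrite expR0; ring.
Qed.

Lemma integral_exp_average l : (\int[P]_w (exp_average l w)%:E = 1)%E.
Proof.
apply: integral_field_average => //; first exact: measurable_exp_field.
exact: integral_exp_field.
Qed.

Lemma integral_exp_average_pow4 l :
  (\int[P]_w ((exp_average l w - 1) ^+ 4)%:E <= (fourth_moment (l ^+ 2))%:E)%E.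
Proof.
apply: integral_field_average_pow4 => //.
- exact: measurable_exp_field.
- exact: integral_exp_field.
- exact: integral_exp_field_pow4.
Qed.

(** The covariance of the field is exp (l^2 r) - 1, where r is the covariance
    of the process; v is its mean over the square. *)
Lemma integral_exp_average_sqr l : exists v,
  (\int[P]_w (exp_average l w ^+ 2)%:E = (1 + v)%:E)%E /\
  l ^+ 2 * Vfun (A * dt) <= v <= l ^+ 2 * expR (l ^+ 2) * Vfun (A * dt).
Proof.
have mr : measurable_fun setT
    (fun z : measurableTypeR R * measurableTypeR R => expR (- (A * `|z.2 - z.1|))).
  apply: measurableT_comp => //; apply: measurableT_comp => //.
  apply: measurable_funM => //; apply: measurableT_comp => //.
  exact: measurable_funB.
have r01 (z : measurableTypeR R * measurableTypeR R) :
    0 <= expR (- (A * `|z.2 - z.1|)) <= 1.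
  by rewrite expR_ge0 expR_le1 oppr_le0 mulr_ge0 ?(ltW A0).
have [v Ev] := exp_kernel_bounds mr r01 (kernel_mean A0 dt0) (sqr_ge0 l).
have E2 := integral_field_average_sqr (uniform_prob dt0) (measurable_exp_field l)
  (exp_field0 l) (integral_exp_field l) (integral_exp_field_mul l).
by exists v; case: Ev => Ev1 Ev2; split=> //; exact: etrans E2 Ev1.
Qed.

End time_average.

(** * Scores at the boundary point *)

Section right_slopes.
Context {R : realType}.

(** The derivative at 0 is proportional to 6 - 12 + 6. *)
Lemma fourth_moment_slope :
  (fourth_moment (2 * h) / h : R) @[h --> (0 : R)^'+] --> 0.
Proof.
have d : is_derive (0 : R) 1 (fun h : R => fourth_moment (2 * h)) 0.
  have e (k : R) := @is_derive_expR_affine R k 0 0.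
  have -> : (fun h : R => fourth_moment (2 * h)) =
      (fun h : R => expR (12 * h + 0)) - 4 *: (fun h : R => expR (6 * h + 0))
      + 6 *: (fun h : R => expR (2 * h + 0)) - cst 3.
    apply/funext => h; rewrite /fourth_moment !fctE /GRing.scale /= !addr0 !mulrA.
    by rewrite -!natrM.
  have dS := is_deriveB (is_deriveD (is_deriveB (e 12) (is_deriveZ 4 (e 6)))
    (is_deriveZ 6 (e 2))) (is_derive_cst (3 : R) (0 : R) 1).
  apply: is_derive_eq dS _.
  by rewrite /GRing.scale /= !mulr0 !add0r expR0; ring.
have k0 : fourth_moment (2 * 0) = 0 :> R.
  by rewrite /fourth_moment !mulr0 expR0; ring.
have : h^-1 *: (((fun h : R => fourth_moment (2 * h)) \o shift 0) (h *: 1) -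
    fourth_moment (2 * 0)) @[h --> (0 : R)^'] --> (0 : R).
  by have [dv dl] := d; rewrite -[X in _ --> X]dl; exact: dv.
move=> /cvg_dnbhs_at_right /=.
rewrite k0; under eq_fun do rewrite subr0 addr0 /GRing.scale /= mulr1 mulrC.
by [].
Qed.

(** Here h is the coordinate mu, so that lambda^2 = 2 h: the variance v is
    2 h V to first order, and the fourth moment is o(h).  The constant C may
    depend on e because e is chosen before h tends to 0. *)
Lemma right_slope_of_second_order (g : R -> R) (p b V : R) : 0 < V ->
  (forall e, 0 < e -> exists2 C, 0 <= C & forall h, 0 < h -> exists v,
     2 * h * V <= v <= 2 * h * expR (2 * h) * V /\
     `|g h - p - b * v| <= e * v + C * fourth_moment (2 * h)) ->
  (g h - p) / h @[h --> 0^'+] --> 2 * b * V.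
Proof.
move=> V0 H; apply/cvgrPdist_le => eps eps0.
(* eps is split into three: e v <= 4 e V h, the fourth moment, and the
   deviation of v / h from 2 V *)
have e0 : 0 < eps / (12 * V) by rewrite divr_gt0// mulr_gt0.
have [C C0 HC] := H _ e0.
have eta0 : 0 < eps / (6 * V * (`|b| + 1)).
  by rewrite divr_gt0// !mulr_gt0// ltr_wpDl.
have exp_near (eta : R) : 0 < eta -> \forall h \near (0 : R)^'+, expR (2 * h) <= 1 + eta.
  move=> eta_gt0.
  have : expR (2 * h) @[h --> (0 : R)^'+] --> (1 : R).
    apply: cvg_at_right_filter.
    have := @continuous_expR_affine R 2 0 0; rewrite /continuous_at mulr0 addr0 expR0.
    by under eq_fun do rewrite addr0.
  move=> /cvgrPdist_le /(_ _ eta_gt0); apply: filterS => h.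
  by rewrite ler_distlC => /andP[_ +]; rewrite addrC.
have k_near : \forall h \near (0 : R)^'+, `|C * (fourth_moment (2 * h) / h)| <= eps / 3.
  have : C * (fourth_moment (2 * h) / h) @[h --> (0 : R)^'+] --> C * 0.
    by apply: cvgM; [exact: cvg_cst|exact: fourth_moment_slope].
  rewrite mulr0 => /cvgrPdist_le /(_ (eps / 3)); rewrite divr_gt0// => /(_ isT).
  by apply: filterS => h; rewrite sub0r normrN.
near=> h.
have h0 : 0 < h by near: h; exact: nbhs_right_gt.
have E1 : expR (2 * h) <= 1 + 1 by near: h; exact: exp_near.
have E2 : expR (2 * h) <= 1 + eps / (6 * V * (`|b| + 1)) by near: h; exact: exp_near.
have K1 : `|C * (fourth_moment (2 * h) / h)| <= eps / 3 by near: h; exact: k_near.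
have [v [/andP[v1 v2] bnd]] := HC h h0.
have -> : 2 * b * V - (g h - p) / h =
   - ((g h - p - b * v) / h) - b * (v / h - 2 * V) by field; rewrite gt_eqF.
have w1 : 2 * V <= v / h by rewrite ler_pdivlMr// mulrAC.
have w2 : v / h <= 2 * expR (2 * h) * V.
  rewrite ler_pdivrMr//; apply: le_trans v2 _.
  by rewrite le_eqVlt; apply/orP; left; apply/eqP; ring.
apply: (le_trans (ler_normB _ _)); rewrite normrN.
have T1 : `|(g h - p - b * v) / h| <= eps / 3 + eps / 3.
  rewrite normrM normfV (gtr0_norm h0) ler_pdivrMr//.
  apply: le_trans bnd _; rewrite [leRHS]mulrDl; apply: lerD.
    have : v / h <= 4 * V by apply: le_trans w2 _; rewrite ler_wpM2r ?(ltW V0)//; lra.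
    rewrite ler_pdivrMr// => vh.
    apply: (@le_trans _ _ (eps / (12 * V) * (4 * V * h))).
      by rewrite ler_wpM2l// ltW.
    by rewrite le_eqVlt; apply/orP; left; apply/eqP; field; rewrite gt_eqF.
  rewrite -ler_pdivrMr// -mulrA; apply: le_trans K1; exact: ler_norm.
have T2 : `|b * (v / h - 2 * V)| <= eps / 3.
  rewrite normrM (ger0_norm (_ : 0 <= v / h - 2 * V)) ?subr_ge0//.
  have B1 : v / h - 2 * V <= 2 * V * (eps / (6 * V * (`|b| + 1))).
    rewrite lerBlDr; apply: le_trans w2 _.
    rewrite [leLHS](_ : _ = 2 * V * expR (2 * h)); last by ring.
    rewrite [leRHS](_ : _ = 2 * V * (1 + eps / (6 * V * (`|b| + 1)))); last by ring.
    by rewrite ler_wpM2l// mulr_ge0// ltW.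
  apply: (@le_trans _ _ ((`|b| + 1) * (2 * V * (eps / (6 * V * (`|b| + 1)))))).
    apply: ler_pM => //; first by rewrite subr_ge0.
    by rewrite lerDl.
  have nb : `|b| + 1 != 0 by rewrite gt_eqF// ltr_wpDl.
  by rewrite le_eqVlt; apply/orP; left; apply/eqP; field; rewrite nb gt_eqF.
apply: le_trans (lerD T1 T2) _; rewrite le_eqVlt; apply/orP; left; apply/eqP; field.
Unshelve. all: by end_near. Qed.

(** The chain rule for a one-sided derivative, by the squeeze
    1 - 1 / u <= ln u <= u - 1 at u = g h / p. *)
Lemma right_slope_ln (g : R -> R) (p L : R) : 0 < p ->
  (g h - p) / h @[h --> 0^'+] --> L ->
  (ln (g h) - ln p) / h @[h --> 0^'+] --> L / p.
Proof.
move=> p0 sl.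
have gp : g h @[h --> (0 : R)^'+] --> p.
  have : (g h - p) / h * h + p @[h --> (0 : R)^'+] --> L * 0 + p.
    apply: cvgD; last exact: cvg_cst.
    by apply: cvgM sl _; apply: cvg_at_right_filter; exact: cvg_id.
  rewrite mulr0 add0r; apply: cvg_trans; apply: near_eq_cvg; near=> h.
  have h0 : 0 < h by near: h; exact: nbhs_right_gt.
  by rewrite divfK ?subrK// gt_eqF.
have lnB (x : R) : 0 < x -> ln x <= x - 1.
  by move=> x0; have := @le_ln1Dx R (x - 1); rewrite subrKC; apply; lra.
apply: (@squeeze_cvgr _ _ _ _ (fun h => (g h - p) / h / g h) (fun h => (g h - p) / h / p)).
- near=> h.
  have h0 : 0 < h by near: h; exact: nbhs_right_gt.
  have g0 : 0 < g h.
    by near: h; move/cvgrPdist_lt : gp => /(_ _ p0); apply: filterS => h;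
       rewrite ltr_distlC => /andP[+ _]; rewrite subrr.
  have gV : 0 < (g h)^-1 by rewrite invr_gt0.
  have pV : 0 < p^-1 by rewrite invr_gt0.
  rewrite -ln_div ?posrE//.
  rewrite ![_ / h / _]mulrAC !ler_wpM2r ?invr_ge0 ?(ltW h0)//=.
    apply: le_trans (lnB _ _) _; first by rewrite divr_gt0.
    by rewrite mulrBl divff// gt_eqF.
  rewrite -[leRHS]opprK lerNr -lnV ?posrE ?divr_gt0// invf_div.
  apply: le_trans (lnB _ _) _; first by rewrite divr_gt0.
  by rewrite mulrBl divff ?gt_eqF// opprB.
- by apply: cvgM sl _; apply: cvgV => //; rewrite gt_eqF.
- by apply: cvgM sl _; exact: cvg_cst.
Unshelve. all: by end_near. Qed.

End right_slopes.

Section scores.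
Context {R : realType} {disp : measure_display} {Omega : measurableType disp}.
Variables (P : probability Omega R) (A dt : R) (Z : R -> Omega -> R).
Hypotheses (A0 : 0 < A) (dt0 : 0 < dt) (OU : stationary_OU P A Z).
Variables (beta : R).
Let c := c_of dt beta.

Lemma p_beta_mu0 (b : R) (y : C2 R) : p_beta_mu P dt Z b 0 y = p_beta dt b y.
Proof.
rewrite /p_beta_mu /p_beta_lambda mulr0 sqrtr0.
have d0 w : delta dt Z 0 w = 0.
  rewrite /delta; under eq_Rintegral do rewrite mul0r expr0n /= mul0r subrr expR0.
  have := @lebesgue_measure_itv R `[0, dt].
  rewrite /= lte_fin dt0 oppr0 adde0 => /(congr1 fine) /= E.
  by rewrite Rintegral_cst// mul1r [X in _ * X]E mulVf ?ln1// gt_eqF.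
under eq_Rintegral do rewrite d0 addr0.
rewrite Rintegral_cst// -[RHS]mulr1; congr (_ * _).
by rewrite [X in fine X]probability_setT.
Qed.

Lemma score_betaE (y : C2 R) :
  score_beta P dt Z beta y = c * log_rate (energy y) (overlap y) c.
Proof.
rewrite /score_beta.
have -> : (fun b => ln (p_beta_mu P dt Z b 0 y)) = @ln R \o (fun b => p_beta dt b y).
  by apply/funext => b /=; rewrite p_beta_mu0.
have p0 := p_beta_gt0 dt0 beta y.
have d := is_derive_p_beta dt0 beta y.
have dl := @is_derive1_comp R (@ln R) (fun b => p_beta dt b y) beta _ _ (is_derive1_ln p0) d.
rewrite derive1E (derive_val (is_derive := dl)) -/c.
by field; rewrite gt_eqF.
Qed.

Lemma p_beta_mu_exp_average (h : R) (y : C2 R) :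
  p_beta_mu P dt Z beta h y =
  \int[P]_w p_beta dt (beta + ln (exp_average Z dt0 (Num.sqrt (2 * h)) w)) y.
Proof.
by rewrite /p_beta_mu /p_beta_lambda; apply: eq_Rintegral => w _;
   rewrite (delta_exp_average dt0 OU).
Qed.

(** The condition on y keeps it off the diagonal, where the density is not
    bounded in beta. *)
Lemma score_muE (y : C2 R) : y.1.1 != y.2.1 ->
  score_mu P dt Z beta y =
  c ^+ 2 * Vfun (A * dt) * curv_rate (energy y) (overlap y) c.
Proof.
move=> y01; rewrite /score_mu.
have p0 := p_beta_gt0 dt0 beta y.
set p := p_beta dt beta y in p0.
pose b := c ^+ 2 * curv_rate (energy y) (overlap y) c * p / 2.
have V0 : 0 < Vfun (A * dt) by apply: Vfun_gt0; rewrite mulr_gt0.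
rewrite (p_beta_mu0 beta y) -/p.
suff /(right_slope_ln p0) sl : (p_beta_mu P dt Z beta h y - p) / h @[h --> (0 : R)^'+] -->
    2 * b * Vfun (A * dt).
  apply/cvg_lim => //; move: sl.
  rewrite (_ : 2 * b * _ / p = c ^+ 2 * Vfun (A * dt) * curv_rate (energy y) (overlap y) c)//.
  by rewrite /b; field; rewrite gt_eqF.
apply: right_slope_of_second_order => // e e0.
have [C HC] := p_beta_taylor dt0 beta y01 e0.
have [B HB] := p_beta_bounded dt0 y01.
exists `|C| => // h h0.
set l := Num.sqrt (2 * h).
have lE : l ^+ 2 = 2 * h by rewrite sqr_sqrtr// mulr_ge0// ltW.
have [v [Ev vb]] := integral_exp_average_sqr A0 dt0 OU l.
exists v; rewrite -lE; split=> //.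
have E4 := integral_exp_average_pow4 dt0 OU l.
have E1 := integral_exp_average dt0 OU l.
have mM := measurable_exp_average dt0 OU l.
have mf := measurable_p_beta_ln dt0 beta y.
have M0 := exp_average_ge0 Z dt0 l.
have fB m : `|p_beta dt (beta + ln m) y| <= B by exact: HB.
have Hb m : `|p_beta dt (beta + ln m) y - p -
    c * log_rate (energy y) (overlap y) c * p * (m - 1) - b * (m - 1) ^+ 2|
    <= e * (m - 1) ^+ 2 + `|C| * (m - 1) ^+ 4.
  by apply: le_trans (HC m) _; rewrite lerD2l ler_wpM2r ?exprn_even_ge0// ler_norm.
have T := expectation_taylor2 mM mf M0 fB (normr_ge0 C) Hb E1 Ev E4.
rewrite p_beta_mu_exp_average; exact: T.
Qed.

End scores.

(** * The Fisher matrix *)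

Import HBNNSimple.

(** The score in mu is a pointwise limit without any control on N, so that
    its measurability is not available.  Instead, simple functions below u are
    set to 0 on N, which keeps their integrals and puts them below v. *)
Lemma integral_eq_off_null d (T : measurableType d) (R : realType)
    (mu : {measure set T -> \bar R}) (N : set T) (f g : T -> \bar R) :
  measurable N -> mu N = 0 -> (forall x, ~ N x -> f x = g x) ->
  (\int[mu]_x f x = \int[mu]_x g x)%E.
Proof.
move=> mN N0 fg.
suff le (u v : T -> \bar R) : (forall x, 0 <= u x)%E -> (forall x, 0 <= v x)%E ->
    (forall x, ~ N x -> u x = v x) -> (\int[mu]_x u x <= \int[mu]_x v x)%E.
  have fgp x : ~ N x -> (f^\+ x = g^\+ x)%E by move=> /fg E; rewrite !funeposE E.
  have fgn x : ~ N x -> (f^\- x = g^\- x)%E by move=> /fg E; rewrite !funenegE E.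
  rewrite [LHS]integralE [RHS]integralE; congr (_ - _)%E.
    by apply/eqP; rewrite eq_le !le// => x Nx; rewrite fgp.
  by apply/eqP; rewrite eq_le !le// => x Nx; rewrite fgn.
move=> u0 v0 uv.
rewrite ge0_integralTE// ge0_integralTE//.
apply: ub_ereal_sup => _ [h hu <-].
pose h' := mul_nnsfun h (indic_nnsfun R (measurableC mN)).
apply: ereal_sup_ubound; exists h'.
  move=> x; have -> : h' x = h x * \1_(~` N) x by [].
  rewrite indicE; have [xN|xN] := boolP (x \in ~` N); last by rewrite mulr0.
  by rewrite mulr1 -uv ?hu//; exact: set_mem xN.
rewrite -!integralT_nnsfun; apply: ae_eq_integral => //; try exact/measurable_EFinP.
exists N; split => // x /= nx; apply: contrapT => Nx; apply: nx => _.
by rewrite mindicE mem_set// mulr1.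
Qed.

Section fisher.
Context {R : realType} {disp : measure_display} {Omega : measurableType disp}.
Variables (P : probability Omega R) (A dt : R) (Z : R -> Omega -> R).
Hypotheses (A0 : 0 < A) (dt0 : 0 < dt) (OU : stationary_OU P A Z).
Variables (beta : R).
Let c := c_of dt beta.
Let rho := expR (- c).
Local Notation leb2 := (@lebesgue_C R).

(** A null set that contains the diagonal y0 = y1 and whose measure is easy
    to compute. *)
Definition equal_real_parts : set (C2 R) := [set y | y.1.1 = y.2.1].

Lemma measurable_equal_real_parts : measurable equal_real_parts.
Proof.
have m : measurable_fun setT (fun y : C2 R => y.1.1 - y.2.1).
  apply: measurable_funB.
  - exact: (measurableT_comp measurable_fst measurable_fst).
  - exact: (measurableT_comp measurable_fst measurable_snd).
have := m measurableT [set 0] (measurable_set1 0).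
rewrite setTI; congr measurable; apply/seteqP; split => y /=.
  by move/eqP; rewrite subr_eq0 => /eqP.
by rewrite /equal_real_parts /= => ->; rewrite subrr.
Qed.

Lemma equal_real_parts_null : (leb2 \x leb2)%E equal_real_parts = 0%E.
Proof.
rewrite /product_measure1 /=.
apply: integral0_eq => y _.
rewrite (_ : xsection equal_real_parts y = [set y.1] `*` setT); last first.
  apply/seteqP; split => z; rewrite /xsection /= inE /equal_real_parts /=.
    by move=> ->.
  by case=> ->.
apply: etrans (product_measure1E _ _ _ _) _ => //.
by rewrite [X in (X * _)%E](_ : _ = 0%E) ?mul0e//; exact: lebesgue_measure_set1.
Qed.

Lemma Rintegral_off_null (f g : C2 R -> R) (a B : R) :
  (forall y, y.1.1 != y.2.1 -> f y = g y) ->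
  has_integral (leb2 \x leb2)%E g a B ->
  \int[(leb2 \x leb2)%E]_y f y = a.
Proof.
move=> fg [_ ga _]; rewrite /Rintegral.
rewrite (integral_eq_off_null (g := fun y => (g y)%:E)
  measurable_equal_real_parts equal_real_parts_null) ?ga// => y Ny.
by rewrite fg//; apply/eqP.
Qed.

Lemma fisherE : fisher P dt Z beta = g_quot (A * dt) c.
Proof.
have c0 : 0 < c := c_of_gt0 dt0 beta.
pose pdf (y : C2 R) := pair_pdf (energy y) (overlap y) c.
have D0 : 1 - rho ^+ 2 != 0 by rewrite gt_eqF// expRN_lt1.
pose q (y : C2 R) := log_rate (energy y) (overlap y) c.
pose k (y : C2 R) := curv_rate (energy y) (overlap y) c.
have pE y : p_beta_mu P dt Z beta 0 y = pdf y.
  by rewrite (p_beta_mu0 P Z dt0 beta) p_betaE.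
have qE y : score_beta P dt Z beta y = c * q y by exact: score_betaE.
have kE y : y.1.1 != y.2.1 -> score_mu P dt Z beta y = c ^+ 2 * Vfun (A * dt) * k y.
  exact: score_muE.
have [B1 H1] := has_integral_log_log c0.
have [B2 H2] := has_integral_log_curv c0.
have [B3 H3] := has_integral_curv_curv c0.
have fE (j l : 'I_2) (C a B a' : R) (g : C2 R -> R) : has_integral (leb2 \x leb2)%E g a B ->
   (forall y, y.1.1 != y.2.1 -> score P dt Z j beta y * score P dt Z l beta y * pdf y = C * g y) ->
   C * a = a' -> fisher P dt Z beta j l = a'.
  move=> Hg E <-; rewrite mxE.
  apply: (Rintegral_off_null (g := fun y => C * g y)); last exact: has_integralZ Hg.
  by move=> y y01; rewrite pE E.
apply/matrixP => j l; rewrite [RHS]mxE.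
have [->|j0] := eqVneq j 0; have [->|l0] := eqVneq l 0.
- apply: (fE _ _ (c ^+ 2) _ _ _ _ H1) => [y y01|].
    by rewrite /score /= qE /q /pdf; ring.
  by rewrite /Ifun -/rho; field.
- apply: (fE _ _ (c ^+ 3 * Vfun (A * dt)) _ _ _ _ H2) => [y y01|].
    by rewrite /score /= (negbTE l0) qE kE// /q /k /pdf; ring.
  by rewrite /Ifun -/rho; field.
- apply: (fE _ _ (c ^+ 3 * Vfun (A * dt)) _ _ _ _ H2) => [y y01|].
    by rewrite /score /= (negbTE j0) qE kE// /q /k /pdf; ring.
  by rewrite /Ifun -/rho; field.
- apply: (fE _ _ (c ^+ 4 * Vfun (A * dt) ^+ 2) _ _ _ _ H3) => [y y01|].
    by rewrite /score /= (negbTE j0) (negbTE l0) !kE// /k /pdf; ring.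
  by rewrite /M2fun -/rho; field.
Qed.

End fisher.

(** * Positivity *)

Section positivity.
Context {R : realType}.
Variables (d c : R) (d0 : 0 < d) (c0 : 0 < c).
Let rho := expR (- c).

Lemma M2fun_sub_Ifun :
  M2fun c - c ^+ 2 * Ifun c =
  4 * c ^+ 4 * rho ^+ 4 * (rho ^+ 2 + 3) * (3 * rho ^+ 2 + 1) / (1 - rho ^+ 2) ^+ 4.
Proof. by rewrite /M2fun /Ifun -/rho; field; rewrite gt_eqF// expRN_lt1. Qed.

Lemma M2fun_sub_Ifun_gt0 : 0 < M2fun c - c ^+ 2 * Ifun c.
Proof.
rewrite M2fun_sub_Ifun divr_gt0 ?exprn_gt0 ?expRN_lt1//.
have r0 : 0 < rho := expR_gt0 _.
by rewrite !mulr_gt0 ?exprn_gt0// addr_gt0 ?mulr_gt0 ?exprn_gt0.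
Qed.

Lemma Ifun_gt0 : 0 < Ifun c.
Proof.
rewrite /Ifun divr_gt0 ?exprn_gt0 ?expRN_lt1//.
by rewrite !mulr_gt0 ?exprn_gt0 ?expR_gt0// ltr_pwDl ?sqr_ge0.
Qed.

Lemma I_eff_g_quot :
  I_eff (g_quot d c) = Vfun d ^+ 2 * (M2fun c - c ^+ 2 * Ifun c).
Proof. by rewrite /I_eff !mxE /=; field; rewrite gt_eqF// Ifun_gt0. Qed.

Lemma I_eff_g_quot_gt0 : 0 < I_eff (g_quot d c).
Proof.
by rewrite I_eff_g_quot mulr_gt0 ?M2fun_sub_Ifun_gt0// exprn_gt0// Vfun_gt0.
Qed.

(** Completing the square in the coordinate beta leaves the Schur complement
    as the coefficient of the other square. *)
Lemma posdefmx_g_quot : posdefmx (g_quot d c).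
Proof.
split.
  by apply/matrixP => i j; rewrite !mxE; case: ifP; case: ifP.
move=> v v0.
have I0 := Ifun_gt0; have V0 := Vfun_gt0 d0; have K0 := M2fun_sub_Ifun_gt0.
have -> : (v *m g_quot d c *m v^T) 0 0 =
  Ifun c * (v 0 0 - c * Vfun d * v 0 1) ^+ 2 +
  Vfun d ^+ 2 * (M2fun c - c ^+ 2 * Ifun c) * v 0 1 ^+ 2.
  rewrite !mxE !big_ord_recl big_ord0 !mxE !big_ord_recl !big_ord0 !mxE /=.
  rewrite (_ : lift ord0 ord0 = 1 :> 'I_2); last exact/val_inj.
  by ring.
have VK : 0 < Vfun d ^+ 2 * (M2fun c - c ^+ 2 * Ifun c) by rewrite mulr_gt0// exprn_gt0.
have [v1|v1] := eqVneq (v 0 1) 0; last first.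
  rewrite ltr_wpDl//; first by rewrite mulr_ge0 ?sqr_ge0// ltW.
  by rewrite mulr_gt0// exprn_even_gt0.
rewrite v1 expr0n /= !mulr0 subr0 addr0 mulr_gt0// exprn_even_gt0//=.
apply: contra_neq v0 => v00; apply/rowP => j; rewrite mxE.
have [->|j1] : j = 0 \/ j = 1.
  by case: j => [[|[|j]] hj] //; [left|right]; exact/val_inj.
  exact: v00.
by rewrite j1.
Qed.

End positivity.

Theorem proposition2p2 (R : realType) (d c rho : R)
    (hd : 0 < d) (hc : 0 < c) (hrho : rho = expR (- c)) :
  (* the Fisher metric at mu = 0 is g_quot d c *)
  (forall (A dt beta : R), 0 < A -> 0 < dt -> d = A * dt -> c = c_of dt beta ->
   forall (disp : measure_display) (Omega : measurableType disp)
     (P : probability Omega R) (Z : R -> Omega -> R),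
     stationary_OU P A Z -> fisher P dt Z beta = g_quot d c) /\
  posdefmx (g_quot d c) /\
  (I_eff (g_quot d c) = Vfun d ^+ 2 * (M2fun c - c ^+ 2 * Ifun c) /\
   0 < I_eff (g_quot d c)) /\
  (M2fun c - c ^+ 2 * Ifun c =
     4 * c ^+ 4 * rho ^+ 4 * (rho ^+ 2 + 3) * (3 * rho ^+ 2 + 1)
       / (1 - rho ^+ 2) ^+ 4 /\
   0 < M2fun c - c ^+ 2 * Ifun c).
Proof.
split.
  move=> A dt beta A0 dt0 dE cE disp Omega P Z OU.
  by rewrite dE cE; exact: fisherE A0 dt0 OU beta.
split; first exact: posdefmx_g_quot.
split; first by split; [exact: I_eff_g_quot|exact: I_eff_g_quot_gt0].
by rewrite hrho; split; [exact: M2fun_sub_Ifun|exact: M2fun_sub_Ifun_gt0].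
Qed.
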